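(* Let $\beta>1$ and assume $F$ is a Von Mises (VM) distribution with $x_F=\infty$. Let $B_k=\overline{Y}_k/k^{\beta-1}$ and $f(x)=E(X-x\mid X>x)$. (i) If there are constants $c>0$ and $\varepsilon>0$ such that $f(x)<\dfrac{cx}{(\log x)^{1+\varepsilon}}$ for all sufficiently large $x$, then $B_k$ converges a.s. to a nondegenerate positive random variable as $k\to\infty$. (ii) If $B_k$ converges a.s., $f$ is monotone, and $\lim_{k\to\infty}E(B_k)<\infty$, then for some constant $x_0>0$, $$\int_{x_0}^\infty\frac{f(x)}{x^2}\,dx<\infty.$$
   Context: Selection rule. $X_1,X_2,\ldots$ are i.i.d. nonnegative random variables with a common absolutely continuous distribution function $F$ such that $1-F(x)>0$ for all $x<\infty$; $X$ denotes a generic variable with distribution $F$. For fixed $\beta\ge 1$, set $T_1=1$, $Y_1=X_1$, and inductively $T_{k+1}=\inf\{i>T_k: X_i>\beta\overline{Y}_k\}$, $Y_{k+1}=X_{T_{k+1}}$, where $\overline{Y}_k=\frac1k\sum_{j=1}^kY_j$ (the ''$\beta$-better than average rule''). VM distribution. Let $x_F=\sup\{x:F(x)<1\}$. $F$, belonging to the domain of attraction of the Gumbel extreme value distribution $\exp\{-e^{-x}\}$, is a Von Mises function (VM) if there exist $x_1$ and $r>0$ such that for $x_1<x<x_F$, $1-F(x)=r\exp\{-\int_{x_1}^x[1/f_A(u)]\,du\}$, where $f_A>0$ on $(x_1,x_F)$, $f_A$ is absolutely continuous on $(x_1,x_F)$ with derivative $f_A'$, and $\lim_{u\nearrow x_F}f_A'(u)=0$.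 Only VM distributions with $x_F=\infty$ are considered. *)

(* Defs.v *)
From HB Require Import structures.
From mathcomp Require Import all_boot all_order all_algebra finmap.
From mathcomp Require Import all_classical all_reals all_analysis.

Set Implicit Arguments.
Unset Strict Implicit.
Unset Printing Implicit Defensive.

Import Order.TTheory GRing.Theory Num.Theory.
Import numFieldTopology.Exports numFieldNormedType.Exports.

Local Open Scope classical_set_scope.
Local Open Scope ring_scope.

Definition mutually_independent d (Omega : measurableType d) (R : realType)
    (P : probability Omega R) (X : nat -> {RV P >-> R}) : Prop :=
  forall (J : {fset nat}) (A : nat -> set R),
    (forall j, j \in J -> measurable (A j)) ->
    P (\bigcap_(j in [set` J]) (X j @^-1` A j)) =
    (\prod_(j <- J) P (X j @^-1` A j))%E.

(* Least [i > n] with [Q i]. When there is none the infimum is infinite; the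
   value [n] returned then is arbitrary. *)
Definition first_after (n : nat) (Q : nat -> bool) : nat :=
  match pselect (exists i, (n < i)%N && Q i) with
  | left h => ex_minn h
  | right _ => n
  end.

(* The "beta-better than average" rule applied to one realisation [x] of the
   sequence. Observations and selections are numbered from 0: [x i] is X_{i+1},
   [sel_time k] is T_{k+1} - 1 and [sel_val k] is Y_{k+1}. On the other hand
   [sel_avg k] is the average of the first [k] selected values, so its index is
   that of the usual notation. *)
Section selection.
Context {R : realType} (beta : R) (x : nat -> R).

(* index of the last selected item and sum of all the selected values *)
Fixpoint sel_state (k : nat) : nat * R :=
  match k with
  | 0%N => (0%N, x 0%N)
  | k'.+1 =>
      let: (t, s) := sel_state k' in
      let t' := first_after t (fun i => beta * (s / k'.+1%:R) < x i) in
      (t', s + x t')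
  end.

Definition sel_time (k : nat) : nat := (sel_state k).1.

Definition sel_val (k : nat) : R := x (sel_time k).

Definition sel_avg (k : nat) : R := (\sum_(j < k) sel_val j) / k%:R.

Lemma sel_state_sum k : (sel_state k).2 = \sum_(j < k.+1) sel_val j.
Proof.
elim: k => [|k IH]; first by rewrite big_ord_recl big_ord0 addr0.
by rewrite big_ord_recr/= -IH /sel_val /sel_time /=; case: (sel_state k).
Qed.

Lemma sel_time0 : sel_time 0 = 0%N. Proof. by []. Qed.

Lemma sel_timeS k :
  sel_time k.+1 =
  first_after (sel_time k) (fun i => beta * sel_avg k.+1 < x i).
Proof.
rewrite /sel_avg -sel_state_sum /sel_time /=.
by case: (sel_state k).
Qed.

End selection.

(* [scaled_avg X beta k] is \overline{Y}_k / k^{beta - 1}, for [k >= 1]. *)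
Definition scaled_avg (Omega : Type) (R : realType) (X : nat -> Omega -> R)
    (beta : R) (k : nat) (w : Omega) : R :=
  sel_avg beta (fun i => X i w) k / k%:R `^ (beta - 1).

(* E(Z | A) for an event [A] of positive probability. *)
Definition event_expectation d (Omega : measurableType d) (R : realType)
    (P : probability Omega R) (A : set Omega) (Z : Omega -> R) : \bar R :=
  ((\int[P]_(w in A) (Z w)%:E) / P A)%E.

Definition mean_residual_life d (Omega : measurableType d) (R : realType)
    (P : probability Omega R) (X : Omega -> R) (x : R) : \bar R :=
  event_expectation P [set w | x < X w] (fun w => X w - x).

(* Domain of attraction of the Gumbel law exp(-e^{-x}). *)
Definition gumbel_attraction (R : realType) (F : R -> R) : Prop :=
  exists a b : nat -> R,
    (forall n, 0 < a n) /\
    forall x, F (a n * x + b n) ^+ n @[n --> \oo] --> expR (- expR (- x)).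

(* [f] is absolutely continuous on ]x1, +oo[ with derivative (density) [g]. *)
Definition abs_continuous_with (R : realType) (x1 : R) (f g : R -> R) : Prop :=
  locally_integrable `]x1, +oo[ g /\
  forall a b, x1 < a -> a <= b ->
    (\int[lebesgue_measure]_(u in `[a, b]) (g u)%:E = (f b - f a)%:E)%E.

(* Von Mises functions with infinite right end point x_F. The extended
   exponential makes the representation fail if the integral diverges, since
   [F x < 1]. *)
Definition von_mises (R : realType) (F : R -> R) : Prop :=
  [/\ forall x, F x < 1,
      gumbel_attraction F &
      exists (x1 r : R) (fA fA' : R -> R),
        [/\ 0 < r,
            forall u, x1 < u -> 0 < fA u,
            abs_continuous_with x1 fA fA',
            fA' u @[u --> +oo] --> 0 &
            forall x, x1 < x ->
              ((1 - F x)%:E = r%:E *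
               expeR (- \int[lebesgue_measure]_(u in `]x1, x[) (fA u)^-1%:E))%E
        ]].

(* Main.v *)
Require Import Defs.
From HB Require Import structures.
From mathcomp Require Import all_boot all_order all_algebra finmap.
From mathcomp Require Import all_classical all_reals all_analysis.
From mathcomp Require Import measurable_realfun ring lra.

Set Implicit Arguments.
Unset Strict Implicit.
Unset Printing Implicit Defensive.

Import Order.TTheory GRing.Theory Num.Theory.
Import numFieldTopology.Exports numFieldNormedType.Exports.

Local Open Scope classical_set_scope.
Local Open Scope ring_scope.

(* Observe the selection in the time of the observations: after X_0, ..., X_i,
   let K + 1 items of total value S be selected. With
     A_k = prod_(j < k) (1 + beta / (j + 1)),   of order k ^ beta,
   the normalized sum M = S / A_K never decreases: a selection of y above the
   threshold V = beta S / (K + 1) adds (y - V) / A_(K + 1) to it. So B_k always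
   converges in [0, +oo], and the limit is at least a multiple of X_0, which is
   positive and unbounded; what is at stake is finiteness.

   (K, S, X_0) is a Markov chain, and E(X - V; X > V) = f(V) P(X > V).
   (i) On {X_0 >= m}, V >= v_K := beta m A_K / (K + 1). The bound on f makes
   M / D_K a supermartingale, where D_k = exp(sum_(j < k) delta_j beta / (j + 1))
   is bounded because sum 1 / (k (ln k) ^ (1 + eps)) telescopes against
   (ln k) ^ (- eps).
   (ii) For f nondecreasing, E(M) dominates P(X_0 > 1) sum_k f(v_k) / A_(k + 1),
   and the integral of f(x) / x ^ 2 over [v_k, v_(k + 1)] is at most a constant
   times f(v_(k + 1)) / A_(k + 2). A nonincreasing f is bounded. *)

(** * Comparison of integrals and of laws *)

(** The integral of a nonnegative function is a supremum over the simple functions below it, so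
    monotonicity holds without measurability. *)
Lemma ge0_le_integral_nonmeasurable d (T : measurableType d) (R : realType)
    (mu : {measure set T -> \bar R}) (f g : T -> \bar R) :
  (forall x, 0 <= f x)%E -> (forall x, f x <= g x)%E ->
  (\int[mu]_x f x <= \int[mu]_x g x)%E.
Proof.
move=> f0 fg.
rewrite !ge0_integralTE//; last by move=> x; exact: le_trans (fg x).
apply: le_ereal_sup => _ [h hf <-]; exists h => // x.
exact: le_trans (fg x).
Qed.

Lemma probability_eq_itvNyc (R : realType) (mu nu : probability R R) :
  (forall x, mu `]-oo, x]%classic = nu `]-oo, x]%classic) ->
  forall A, measurable A -> mu A = nu A.
Proof.
move=> h A mA.
apply: (@measure_unique _ R R (@RGenOInfty.G R)
  (fun n => `](- n%:R), +oo[%classic) _ _ _ _ mu nu _ _ A mA).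
- exact: RGenOInfty.measurableE.
- move=> _ _ [x ->] [y ->]; exists (Num.max x y).
  by apply/seteqP; split => z /=; rewrite !in_itv/= !andbT gt_max => /andP.
- by move=> n; exists (- n%:R).
- apply/seteqP; split => // x _; exists (Num.bound `|x|) => //=.
  rewrite in_itv/= andbT ltrNl (le_lt_trans (ler_norm _))// normrN.
  exact: archi_boundP.
- move=> _ [x ->].
  rewrite -setCitvl; transitivity (1 - mu `]-oo, x]%classic)%E.
    exact: probability_setC.
  by rewrite h; apply/esym; exact: probability_setC.
- by move=> n; rewrite (le_lt_trans (probability_le1 _ _))// ltry.
Qed.

(** * Markov chains driven by independent variables *)

Fixpoint run (R T : Type) (phi : R -> T) (step : T * R -> T) (x : nat -> R)
    (i : nat) : T :=
  match i with
  | 0%N => phi (x 0%N)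
  | j.+1 => step (run phi step x j, x j.+1)
  end.

Section chain.
Context d (Omega : measurableType d) (R : realType) (P : probability Omega R).
Variable X : nat -> {RV P >-> R}.
Context d' (T : measurableType d').
Variables (phi : R -> T) (step : T * R -> T).

Definition chain (i : nat) (w : Omega) : T := run phi step (X ^~ w) i.

Hypotheses (mphi : measurable_fun setT phi) (mstep : measurable_fun setT step).

Lemma measurable_chain i : measurable_fun setT (chain i).
Proof.
elim: i => [|i IH]; first exact: measurableT_comp.
by apply: (measurableT_comp mstep); exact: measurable_fun_pair.
Qed.

Hypothesis X_indep : mutually_independent X.

Let cyl (J : {fset nat}) (A : nat -> set R) :=
  \bigcap_(j in [set` J]) (X j @^-1` A j).

Let measurable_cyl J A : (forall j, j \in J -> measurable (A j)) ->
  measurable (cyl J A).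
Proof.
move=> mA; rewrite /cyl; apply: fin_bigcap_measurable => // j jJ.
by rewrite -[X in measurable X]setTI; apply: measurable_funP => //; exact: mA.
Qed.

Let indep_cons i B J A : measurable B -> i \notin J ->
  (forall j, j \in J -> measurable (A j)) ->
  P (X i @^-1` B `&` cyl J A) = (P (X i @^-1` B) * P (cyl J A))%E.
Proof.
move=> mB iJ mA.
pose A' j := if j == i then B else A j.
have A'A j : j \in J -> A' j = A j.
  by move=> jJ; rewrite /A'; case: eqP => // ji; rewrite -ji jJ in iJ.
have E : X i @^-1` B `&` cyl J A = cyl (i |` J)%fset A'.
  rewrite /cyl bigcap_fsetU1 /A' eqxx; congr (_ `&` _).
  by apply: eq_bigcapr => j jJ; rewrite -/(A' j) A'A.
rewrite E /cyl !X_indep//; last first.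
  move=> j; rewrite inE => /orP[/[!inE]/eqP ->|jJ]; first by rewrite /A' eqxx.
  by rewrite A'A//; exact: mA.
rewrite big_fsetU1//= /A' eqxx; congr (_ * _)%E.
by apply: eq_big_seq => j jJ; rewrite -/(A' j) A'A.
Qed.

(* Keeping all the finite families of later observations in the statement is
   what makes the induction on [i] go through. *)
Lemma chain_indep i (J : {fset nat}) (A : nat -> set R) (C : set T) :
  measurable C -> (forall j, j \in J -> (i < j)%N) ->
  (forall j, j \in J -> measurable (A j)) ->
  P (chain i @^-1` C `&` \bigcap_(j in [set` J]) (X j @^-1` A j)) =
  (P (chain i @^-1` C) * P (\bigcap_(j in [set` J]) (X j @^-1` A j)))%E.
Proof.
elim: i J A C => [|i IH] J A C mC iJ mA.
  apply: (@indep_cons 0%N (phi @^-1` C)) => //.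
    by rewrite -[X in measurable X]setTI; exact: mphi.
  by apply/negP => /iJ.
have mD := measurable_cyl mA.
(* The next state is a function of the pair [W]. The law of [W] restricted to the cylinder and its
   law scaled by the probability of the cylinder agree on rectangles, which suffices to identify
   them. *)
pose W w := (chain i w, X i.+1 w).
have mW : measurable_fun setT W.
  by apply: measurable_fun_pair => //; exact: measurable_chain.
have finD : P (cyl J A) \is a fin_num by exact: fin_num_measure.
pose r : {nonneg R} := NngNum (fine_ge0 (measure_ge0 P (cyl J A))).
pose m1 : {measure set (T * R) -> \bar R} := pushforward (mrestr P mD) W.
pose m2 : {measure set (T * R) -> \bar R} := mscale r (pushforward P W).
pose n1 := m1 mW.
pose n2 := m2 mW.
have n1E E : n1 E = P (W @^-1` E `&` cyl J A) by [].
have n2E E : n2 E = (P (cyl J A) * P (W @^-1` E))%E.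
  by rewrite -[in RHS](fineK finD).
have n12 : forall E, measurable E -> n1 E = n2 E.
  move=> E mE; apply: (@measure_unique _ R (T * R)%type
    [set A `*` B | A in measurable & B in measurable] (fun=> setT)
    _ _ _ _ n1 n2 _ _ E mE).
  - exact: measurable_prod_measurableType.
  - move=> _ _ [A1 mA1 [A2 mA2 <-]] [B1 mB1 [B2 mB2 <-]].
    exists (A1 `&` B1); first exact: measurableI.
    exists (A2 `&` B2); first exact: measurableI.
    by rewrite setXI.
  - by move=> _; exists setT => //; exists setT => //; rewrite setXTT.
  - by rewrite bigcup_const.
  - move=> _ [C' mC' [B mB <-]].
    rewrite n1E n2E.
    have -> : W @^-1` (C' `*` B) = chain i @^-1` C' `&` X i.+1 @^-1` B by [].
    pose A' j := if j == i.+1 then B else A j.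
    have iJ' : i.+1 \notin J by apply/negP => /iJ; rewrite ltnn.
    (* The event on [X i.+1] joins the cylinder, so that the induction hypothesis at [i] applies to
       the larger family. *)
    have E1 : X i.+1 @^-1` B `&` cyl J A = cyl (i.+1 |` J)%fset A'.
      rewrite /cyl bigcap_fsetU1 /A' eqxx; congr (_ `&` _).
      apply: eq_bigcapr => j /= jJ; case: eqP => // ji.
      by rewrite ji in jJ; rewrite jJ in iJ'.
    have E2 : X i.+1 @^-1` B = cyl [fset i.+1]%fset (fun=> B).
      by rewrite /cyl; apply/seteqP; split => [w Bw j /= /[!inE]/eqP ->//|w];
        apply => /=; rewrite inE.
    have E3 : P (chain i @^-1` C' `&` X i.+1 @^-1` B) =
        (P (chain i @^-1` C') * P (X i.+1 @^-1` B))%E.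
      by rewrite E2 IH// => j; rewrite inE => /eqP ->.
    rewrite E3 -setIA E1 IH//; last 2 first.
    + move=> j; rewrite inE => /orP[/[!inE]/eqP ->//|/iJ]; exact: ltnW.
    + move=> j; rewrite /A' inE; case: eqP => // ji /orP[|/mA//].
      by rewrite inE => /eqP /ji.
    by rewrite -/(cyl _ _) -E1 indep_cons// muleA muleC.
  - move=> _; rewrite n1E.
    rewrite setTI (le_lt_trans (probability_le1 _ _)) ?ltry//.
have mS : measurable (step @^-1` C).
  by rewrite -[X in measurable X]setTI; exact: mstep.
by have := n12 _ mS; rewrite n1E n2E muleC.
Qed.

(** The state at time [i] and the next observation are independent, so their joint law is a product
    measure and Tonelli integrates the observation first. This is the Markov property in the form
    used below. *)
Lemma integral_chain_next i (psi : T * R -> \bar R) :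
  measurable_fun setT psi -> (forall z, 0 <= psi z)%E ->
  (\int[P]_w psi (chain i w, X i.+1 w) =
   \int[P]_w \int[distribution P (X i.+1)]_y psi (chain i w, y))%E.
Proof.
move=> mpsi psi0.
pose W w := (chain i w, X i.+1 w).
have mW : measurable_fun setT W.
  by apply: measurable_fun_pair => //; exact: measurable_chain.
pose W' : {mfun Omega >-> (T * R)%type} :=
  HB.pack W (isMeasurableFun.Build _ _ _ _ _ mW).
pose U : {mfun Omega >-> T} :=
  HB.pack (chain i) (isMeasurableFun.Build _ _ _ _ _ (@measurable_chain i)).
have WE : forall E, measurable E ->
    ((distribution P U : probability _ _) \x distribution P (X i.+1))%E E =
    distribution P W' E.
  apply: product_measure_unique => C B mC mB.
  have E2 : X i.+1 @^-1` B = \bigcap_(j in [set` [fset i.+1]%fset]) (X j @^-1` B).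
    by apply/seteqP; split => [w Bw j /= /[!inE]/eqP ->//|w];
      apply => /=; rewrite inE.
  suff : P (chain i @^-1` C `&` X i.+1 @^-1` B) =
    (P (chain i @^-1` C) * P (X i.+1 @^-1` B))%E by [].
  rewrite E2 (@chain_indep i [fset i.+1]%fset (fun=> B))//.
  by move=> j; rewrite inE => /eqP ->.
have -> : (\int[P]_w psi (chain i w, X i.+1 w) =
    \int[distribution P W']_z psi z)%E.
  by rewrite ge0_integral_distribution.
transitivity (\int[((distribution P U : probability _ _) \x
    distribution P (X i.+1))%E]_z psi z)%E.
  by apply: eq_measure_integral => E mE _; apply/esym; exact: WE.
rewrite fubini_tonelli1// ge0_integral_distribution//.
  exact: measurable_fun_fubini_tonelli_F.
by move=> t; exact: integral_ge0.
Qed.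

End chain.

(** * The selection rule along one realisation *)

Lemma first_afterP (n : nat) (Q : nat -> bool) :
  (exists i, (n < i)%N && Q i) ->
  [/\ (n < first_after n Q)%N, Q (first_after n Q) &
      forall i, (n < i)%N -> (i < first_after n Q)%N -> ~~ Q i].
Proof.
move=> h; rewrite /first_after; case: pselect => // h'.
case: ex_minnP => m /andP[nm Qm] minm; split => // i ni im.
by apply/negP => Qi; have := minm i; rewrite ni Qi => /(_ isT); rewrite leqNgt im.
Qed.

Section growth.
Context {R : realType} (beta : R).

(** The [A_k] of the overview: Gamma(k + 1 + beta) / (k! Gamma(1 + beta)). *)
Definition growth (k : nat) : R := \prod_(j < k) (1 + beta / j.+1%:R).

Lemma growthS k : growth k.+1 = growth k * (1 + beta / k.+1%:R).
Proof. by rewrite /growth big_ord_recr. Qed.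

Lemma growth0 : growth 0 = 1. Proof. by rewrite /growth big_ord0. Qed.

Lemma growth_gt0 k : 0 <= beta -> 0 < growth k.
Proof.
move=> b0; elim: k => [|k IH]; first by rewrite growth0.
by rewrite growthS mulr_gt0// ltr_pwDl// divr_ge0.
Qed.

End growth.

Section state.
Context {R : realType} (beta : R).

(* A state [((k, s), x0)] records that [k.+1] items of total value [s] have been
   selected so far, and that the first observation is [x0]. *)
Definition threshold (u : nat * R * R) : R := beta * (u.1.2 / u.1.1.+1%:R).

Definition select_init (x : R) : nat * R * R := ((0%N, x), x).

Definition select_step (z : (nat * R * R) * R) : nat * R * R :=
  if threshold z.1 < z.2 then ((z.1.1.1.+1, z.1.1.2 + z.2), z.1.2) else z.1.

Definition normalized_sum (u : nat * R * R) : R := u.1.2 / growth beta u.1.1.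

Lemma measurable_fun_nat d (T : measurableType d) (g : nat -> T) :
  measurable_fun setT g.
Proof. by []. Qed.

Lemma measurable_select_init : measurable_fun setT select_init.
Proof. by do 2 apply: measurable_fun_pair => //. Qed.

Lemma measurable_comp_count d (T : measurableType d) (g : nat -> T) :
  measurable_fun setT (fun u : nat * R * R => g u.1.1).
Proof.
by apply: (measurableT_comp (measurable_fun_nat g)); exact: measurableT_comp.
Qed.

Lemma measurable_total : measurable_fun setT (fun u : nat * R * R => u.1.2).
Proof. exact: measurableT_comp. Qed.

Lemma measurable_threshold : measurable_fun setT threshold.
Proof.
apply: measurable_funM => //; apply: measurable_funM; first exact: measurable_total.
exact: (@measurable_comp_count _ R (fun k => k.+1%:R^-1)).
Qed.

Lemma measurable_select_step : measurable_fun setT select_step.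
Proof.
apply: measurable_fun_ifT => //.
  apply: measurable_fun_ltr => //.
  by apply: (measurableT_comp measurable_threshold).
apply: measurable_fun_pair => /=; last exact: measurableT_comp.
apply: measurable_fun_pair => /=.
  by apply: (measurableT_comp (measurable_comp_count S)).
apply: measurable_funD => //.
by apply: (measurableT_comp measurable_total).
Qed.

Lemma measurable_normalized_sum : measurable_fun setT normalized_sum.
Proof.
apply: measurable_funM; first exact: measurable_total.
exact: (@measurable_comp_count _ R (fun k => (growth beta k)^-1)).
Qed.

Hypothesis beta_ge1 : 1 <= beta.

Let beta_ge0 : 0 <= beta. Proof. exact: le_trans beta_ge1. Qed.
Let g_gt0 k : 0 < growth beta k. Proof. exact: growth_gt0. Qed.

Lemma thresholdE u : threshold u =
  beta / u.1.1.+1%:R * growth beta u.1.1 * normalized_sum u.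
Proof.
rewrite /threshold /normalized_sum; have := g_gt0 u.1.1.
move: (growth _ _) => g g0.
have : u.1.1.+1%:R != 0 :> R by rewrite pnatr_eq0.
move: (_.+1%:R) u.1.2 => n s n0; field.
by rewrite gt_eqF.
Qed.

(** With [V] the threshold, a selection adds [y = V + (y - V)], and
    [s + V = s * (1 + beta / k.+1%:R)]: the part [V] is exactly absorbed by passing to the next
    growth factor. *)
Lemma normalized_sum_step u y : normalized_sum (select_step (u, y)) =
  normalized_sum u + Num.max (y - threshold u) 0 / growth beta u.1.1.+1.
Proof.
rewrite /select_step /=; case: ltP => h.
  rewrite max_l ?subr_ge0 ?ltW//.
  rewrite /normalized_sum /threshold /= growthS.
  have g0 := g_gt0 u.1.1.
  have n0 : (0 : R) < u.1.1.+1%:R by rewrite ltr0n.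
  move: (growth _ _) g0 (_.+1%:R) n0 u.1.2 => g g0 n n0 s; field.
  by rewrite !gt_eqF// ltr_pwDl.
by rewrite max_r ?subr_le0// mul0r addr0.
Qed.

Lemma normalized_sum_step_le u y :
  normalized_sum u <= normalized_sum (select_step (u, y)).
Proof.
by rewrite normalized_sum_step lerDl divr_ge0 ?(ltW (g_gt0 _))// le_max lexx orbT.
Qed.

Lemma count_step u y :
  (select_step (u, y)).1.1 = (u.1.1 + (threshold u < y)%R)%N.
Proof. by rewrite /select_step /=; case: ifP; rewrite ?addn1 ?addn0. Qed.

Section path.
Variables (x : nat -> R) (x_ge0 : forall i, 0 <= x i).

Let st i := run select_init select_step x i.

Lemma run_first i : (st i).2 = x 0%N.
Proof. by elim: i => // i IH; rewrite /st /= /select_step /=; case: ifP. Qed.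

Lemma normalized_sum_homo i j : (i <= j)%N ->
  normalized_sum (st i) <= normalized_sum (st j).
Proof.
move=> /subnK <-; elim: (j - i)%N => // n IH.
by rewrite (le_trans IH)// addSn; exact: normalized_sum_step_le.
Qed.

Lemma count_homo i j : (i <= j)%N -> ((st i).1.1 <= (st j).1.1)%N.
Proof.
move=> /subnK <-; elim: (j - i)%N => // n IH.
by rewrite (leq_trans IH)// addSn/= count_step leq_addr.
Qed.

Lemma normalized_sum_ge_first i : x 0%N <= normalized_sum (st i).
Proof.
apply: le_trans (normalized_sum_homo (leq0n i)).
by rewrite /normalized_sum /= growth0 divr1.
Qed.

Hypothesis x_unbounded : forall N n : nat, exists2 i, (n < i)%N & N%:R < x i.

Let found (n : nat) (v : R) : exists i, (n < i)%N && (v < x i).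
Proof.
have [i ni xi] := x_unbounded (Num.bound `|v|) n; exists i; rewrite ni /=.
by rewrite (le_lt_trans (ler_norm v))// (lt_trans _ xi)// archi_boundP.
Qed.

(** No observation strictly between two selection times exceeds the threshold, so the state is
    constant there and the chain read at selection times follows the recursion of [sel_state]. *)
Lemma run_sel_time k :
  st (sel_time beta x k) = ((k, (sel_state beta x k).2), x 0%N).
Proof.
elim: k => // k IH.
have [lt1 _ h] := first_afterP (found (sel_time beta x k)
  (beta * sel_avg beta x k.+1)).
move: lt1 h; rewrite -sel_timeS => lt1 h.
have thE u : st u = st (sel_time beta x k) ->
    threshold (st u) = beta * sel_avg beta x k.+1.
  by move=> ->; rewrite IH /threshold /= /sel_avg -sel_state_sum.
have const j : (sel_time beta x k + j < sel_time beta x k.+1)%N ->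
    st (sel_time beta x k + j) = st (sel_time beta x k).
  elim: j => [|j IHj]; first by rewrite addn0.
  rewrite addnS => lt2; have lt3 := ltnW lt2.
  rewrite /st /= /select_step /= -/(st _) thE ?IHj//.
  by rewrite (negbTE (h _ _ lt2))// ltnS leq_addr.
(* [sel_time beta x k + m] is the index just before the next selection. *)
have [m tm] : exists m, sel_time beta x k.+1 = (sel_time beta x k + m).+1.
  exists (sel_time beta x k.+1 - (sel_time beta x k).+1)%N.
  by rewrite -addSn subnKC.
have := first_afterP (found (sel_time beta x k) (beta * sel_avg beta x k.+1)).
rewrite -sel_timeS => -[_ xt _].
have lt2 : (sel_time beta x k + m < sel_time beta x k.+1)%N by rewrite tm.
have -> : st (sel_time beta x k.+1) =
    select_step (st (sel_time beta x k + m), x (sel_time beta x k.+1)).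
  by rewrite [in LHS]tm /st /= -tm.
rewrite /select_step /= thE ?const// xt IH /=.
congr (_, _, _); rewrite /sel_time /=.
by case: (sel_state beta x k).
Qed.

Lemma leq_sel_time k : (k <= sel_time beta x k)%N.
Proof.
elim: k => // k IH; apply: (leq_ltn_trans IH).
by have [] := first_afterP (found (sel_time beta x k)
  (beta * sel_avg beta x k.+1)); rewrite -sel_timeS.
Qed.

(** A sum of k + 1 selected values is divided by [growth beta k] in the chain and by (k + 1)^beta in
    the scaled average, whence the correcting ratio. *)
Lemma scaled_avgE k :
  sel_avg beta x k.+1 / k.+1%:R `^ (beta - 1) =
  normalized_sum (st (sel_time beta x k)) * (growth beta k / k.+1%:R `^ beta).
Proof.
rewrite run_sel_time /normalized_sum /= sel_state_sum /sel_avg.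
have -> : k.+1%:R `^ beta = k.+1%:R * k.+1%:R `^ (beta - 1) :> R.
  by rewrite mulr_powRB1// (lt_le_trans ltr01).
have := g_gt0 k; move: (growth _ _) => g g0.
have : k.+1%:R != 0 :> R by rewrite pnatr_eq0.
have : (0 : R) < k.+1%:R `^ (beta - 1) by rewrite powR_gt0.
move: (_ `^ _) => q q0; move: (_.+1%:R) => n n0; field.
by rewrite n0 !gt_eqF.
Qed.

Lemma count_sel_time n i : (sel_time beta x n <= i)%N -> (n <= (st i).1.1)%N.
Proof. by move=> /count_homo; rewrite run_sel_time. Qed.

End path.

End state.

(** * Asymptotics of the growth factors *)

(** Young's inequality for the product of 1 + y and 1, with the conjugate exponents beta and beta /
    (beta - 1). *)
Lemma bernoulli_powR (R : realType) (beta y : R) : 1 < beta -> 0 <= y ->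
  1 + beta * y <= (1 + y) `^ beta.
Proof.
move=> b1 y0; have b0 : 0 < beta by rewrite (lt_trans ltr01).
have bb0 : 0 < beta - 1 by rewrite subr_gt0.
have := @conjugate_powR R (1 + y) 1 beta (beta / (beta - 1)) (addr_ge0 ler01 y0)
  ler01 b0 (divr_gt0 b0 bb0).
have -> : beta^-1 + (beta / (beta - 1))^-1 = 1.
  by field; rewrite !gt_eqF.
move=> /(_ erefl); rewrite mulr1 powR1.
move: (_ `^ _) => q h.
have : beta * (1 + y) <= beta * (q / beta + 1 / (beta / (beta - 1))).
  by rewrite ler_pM2l.
have -> : beta * (q / beta + 1 / (beta / (beta - 1))) = q + (beta - 1).
  by field; rewrite !gt_eqF.
by rewrite mulrDr; lra.
Qed.

Section growth_asymptotics.
Context {R : realType} (beta : R).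
Hypothesis beta_gt1 : 1 < beta.
Let beta_gt0 : 0 < beta. Proof. exact: lt_trans beta_gt1. Qed.
Let g_gt0 k : 0 < growth beta k. Proof. by apply: growth_gt0; exact: ltW. Qed.

(* [growth k / (k + 1 + beta) ^ beta] is nondecreasing: with
   [n = k + 1 + beta], one has [(1 + 1 / n) ^ beta <= expR (beta / n)] and
   [expR (- (beta / n)) >= 1 - beta / n]. *)
Lemma growth_ge : exists2 c : R, 0 < c &
  forall k, c * k.+1%:R `^ beta <= growth beta k.
Proof.
have D0 : (0 : R) < (1 + beta) `^ beta by rewrite powR_gt0// addr_gt0.
exists ((1 + beta) `^ beta)^-1; first by rewrite invr_gt0.
suff H k : ((1 + beta) `^ beta)^-1 * (k.+1%:R + beta) `^ beta <= growth beta k.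
  move=> k; apply: le_trans (H k); rewrite ler_pM2l ?invr_gt0//.
  by apply: ge0_ler_powR; rewrite ?nnegrE ?lerDl ?addr_ge0 // ltW.
elim: k => [|k IH]; first by rewrite growth0 mulVf// gt_eqF.
rewrite growthS.
set n : R := k.+1%:R + beta.
have k0 : (0 : R) < k.+1%:R by rewrite ltr0n.
have n0 : 0 < n by rewrite addr_gt0.
have -> : k.+2%:R + beta = n * (1 + n^-1).
  by rewrite mulrDr mulr1 mulfV ?gt_eqF// /n -(natr1 k.+1); lra.
rewrite powRM ?(ltW n0)//; last by rewrite addr_ge0// invr_ge0 ltW.
rewrite mulrA; apply: ler_pM => //.
- by rewrite mulr_ge0 ?powR_ge0// invr_ge0 ltW.
- exact: powR_ge0.
apply: (@le_trans _ _ (expR (beta / n))).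
  rewrite mulrC expRM; apply: ge0_ler_powR; rewrite ?nnegrE ?expR_ge0//.
  + exact: ltW.
  + by rewrite addr_ge0// invr_ge0 ltW.
  + exact: expR_ge1Dx.
have e1 := expR_ge1Dx (- (beta / n)); rewrite expRN in e1.
have e0 := expR_gt0 (beta / n).
(* The shift by [beta] in [n] makes these two factors exact inverses. *)
have E : (1 + beta / k.+1%:R) * (1 - beta / n) = 1.
  rewrite /n; move: (_.+1%:R) k0 => m m0; field.
  by rewrite !gt_eqF// addr_gt0.
have q0 : 0 < 1 + beta / k.+1%:R by rewrite addr_gt0// divr_gt0.
by rewrite -(ler_pM2l q0) E ler_pdivlMr// mul1r in e1.
Qed.

(** The ratio is nonincreasing by Bernoulli's inequality at 1 / (k + 1), and [growth_ge] keeps it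
    away from 0. *)
Lemma growth_ratio_cvg : exists2 rho : R, 0 < rho &
  growth beta k / k.+1%:R `^ beta @[k --> \oo] --> rho.
Proof.
have [c c0 gc] := growth_ge.
set r := fun k => growth beta k / k.+1%:R `^ beta.
have p0 k : (0 : R) < k.+1%:R `^ beta by rewrite powR_gt0.
have cr k : c <= r k by rewrite ler_pdivlMr.
have r_dec : {homo r : n m / (n <= m)%N >-> m <= n}.
  apply/nonincreasing_seqP => k; rewrite /r.
  have k0 : (0 : R) < k.+1%:R by rewrite ltr0n.
  have -> : k.+2%:R = k.+1%:R * (1 + k.+1%:R^-1) :> R.
    by rewrite mulrDr mulr1 mulfV ?gt_eqF// natr1.
  rewrite growthS powRM ?(ltW k0)//.
  rewrite ler_pdivrMr; last by rewrite mulr_gt0// powR_gt0// addr_gt0// invr_gt0.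
  rewrite mulrA divfK ?gt_eqF// ler_pM2l//.
  by apply: bernoulli_powR => //; rewrite invr_ge0 ltW.
have cv : cvgn r.
  apply: nonincreasing_is_cvgn => //.
  by exists c => _ [k _ <-].
exists (limn r) => //; apply: lt_le_trans c0 _.
by apply: limr_ge => //; exact: nearW.
Qed.

End growth_asymptotics.

(** * Summability of the relative drift *)

(** From [n0] on the sum telescopes to at most [r n0]; the earlier terms, of arbitrary sign, are
    bounded by their absolute values. *)
Lemma sum_le_of_telescope (R : realType) (u r : nat -> R) (n0 : nat) :
  (forall k, 0 <= r k) -> (forall k, (n0 <= k)%N -> u k <= r k - r k.+1) ->
  exists C, forall n, \sum_(k < n) u k <= C.
Proof.
move=> r0 ur.
exists (\sum_(k < n0) `|u k| + r n0) => n.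
have [nn0|n0n] := leqP n n0.
  rewrite (@le_trans _ _ (\sum_(k < n0) `|u k|)) ?lerDl//.
  rewrite -(big_mkord predT u) -(big_mkord predT (fun k => `|u k|)).
  rewrite [leRHS](big_cat_nat (n := n))//=.
  rewrite (@le_trans _ _ (\sum_(0 <= k < n) `|u k|))//.
    by apply: ler_sum => k _; exact: ler_norm.
  by rewrite lerDl sumr_ge0.
rewrite -(big_mkord predT u) (big_cat_nat (n := n0))//=; last exact: ltnW.
apply: lerD.
  by rewrite big_mkord; apply: ler_sum => k _; exact: ler_norm.
apply: (@le_trans _ _ (\sum_(n0 <= k < n) (- r k.+1 - - r k))).
  by apply: ler_sum_nat => k /andP[kn _]; rewrite opprK addrC; exact: ur.
rewrite (telescope_sumr (fun k => - r k)) ?(ltnW n0n)//.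
by rewrite opprK addrC gerBl.
Qed.

(** The bound ln(1 + x) <= x at x = -1 / (k + 2). *)
Lemma ln_nat_diff (R : realType) (k : nat) :
  k.+2%:R^-1 <= ln k.+2%:R - ln k.+1%:R :> R.
Proof.
have k0 : (0 : R) < k.+2%:R by rewrite ltr0n.
have k1 : (0 : R) < k.+1%:R by rewrite ltr0n.
have : -1 < - k.+2%:R^-1 :> R by rewrite ltrN2 invf_lt1// ltr1n.
move=> /le_ln1Dx.
have -> : 1 + - k.+2%:R^-1 = k.+1%:R / k.+2%:R :> R.
  rewrite -[X in X + _](@mulfV _ k.+2%:R) ?gt_eqF// -[X in _ - X]mul1r -mulrBl.
  by rewrite -(natr1 k.+1) addrK.
by rewrite ln_div ?posrE// lerNr opprB.
Qed.

(** This is the mean value bound for t^(-eps), obtained from (b / a)^eps >= 1 + eps ln(b / a) >= 1 +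
    eps (1 - a / b). *)
Lemma powRN_diff (R : realType) (eps a b : R) : 0 < eps -> 0 < a -> a <= b ->
  eps * (b - a) / b `^ (1 + eps) <= a `^ (- eps) - b `^ (- eps).
Proof.
move=> e0 a0 ab; have b0 := lt_le_trans a0 ab.
have -> : a `^ (- eps) = b `^ (- eps) * (b / a) `^ eps.
  have h : b `^ eps = (b / a) `^ eps * a `^ eps.
    by rewrite -powRM ?divfK ?gt_eqF ?divr_ge0 ?(ltW a0) ?(ltW b0).
  rewrite !powRN h; have : 0 < a `^ eps by rewrite powR_gt0.
  have : 0 < (b / a) `^ eps by rewrite powR_gt0// divr_gt0.
  move: (_ `^ _) (a `^ _) => p q p0 q0; field.
  by rewrite !gt_eqF.
have -> : b `^ (1 + eps) = b * b `^ eps.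
  by rewrite powRD ?powRr1 ?(ltW b0)// (gt_eqF b0) implybT.
rewrite powRN; set q := b `^ eps.
have q0 : 0 < q by rewrite powR_gt0.
have -> : eps * (b - a) / (b * q) = q^-1 * (eps * (1 - a / b)).
  by field; rewrite !gt_eqF.
rewrite -[X in _ <= _ - X]mulr1 -mulrBr ler_pM2l ?invr_gt0//.
rewrite lerBrDl /powR gt_eqF ?divr_gt0//.
apply: le_trans (expR_ge1Dx _); rewrite lerD2l ler_pM2l//.
have : -1 < a / b - 1 by rewrite ltrBrDr addNr divr_gt0.
by move=> /le_ln1Dx; rewrite addrC subrK !ln_div ?posrE//; lra.
Qed.

Lemma powR_nat_unbounded (R : realType) (g y : R) : 0 < g ->
  exists k0, forall k, (k0 <= k)%N -> y <= k.+1%:R `^ g.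
Proof.
move=> g0; pose z := Num.max y 1.
have z0 : 0 < z by rewrite lt_max ltr01 orbT.
exists (Num.bound (z `^ g^-1)) => k hk.
apply: (@le_trans _ _ z); first by rewrite le_max lexx.
have -> : z = (z `^ g^-1) `^ g by rewrite -powRrM mulVf ?gt_eqF// powRr1// ltW.
apply: ge0_ler_powR; rewrite ?nnegrE ?powR_ge0 ?(ltW g0)//.
apply: ltW; apply: (lt_le_trans (archi_boundP (powR_ge0 _ _))).
by rewrite ler_nat leqW.
Qed.

Section drift.
Context {R : realType} (beta : R).
Hypothesis beta_gt1 : 1 < beta.

(* The threshold of a state with [k.+1] items selected and normalized sum [m]. *)
Definition min_threshold (m : R) (k : nat) : R := beta / k.+1%:R * growth beta k * m.

Lemma min_threshold_ge (m : R) : 0 < m -> exists2 a : R, 0 < a &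
  forall k, a * k.+1%:R `^ (beta - 1) <= min_threshold m k.
Proof.
move=> m0; have [c c0 gc] := growth_ge beta_gt1.
have b0 : 0 < beta by rewrite (lt_trans ltr01).
exists (beta * m * c); first by rewrite !mulr_gt0.
move=> k; have k0 : (0 : R) < k.+1%:R by rewrite ltr0n.
have := gc k; rewrite -(@mulr_powRB1 _ k.+1%:R beta) ?(ltW k0)//.
move=> gk; rewrite /min_threshold.
have -> : beta / k.+1%:R * growth beta k * m = beta * m * (growth beta k / k.+1%:R).
  by move: (_^-1) (growth _ _) => q g; ring.
rewrite -mulrA ler_pM2l ?mulr_gt0// ler_pdivlMr//.
by rewrite (le_trans _ gk)// -mulrA [X in _ <= _ * X]mulrC.
Qed.

(** The least threshold grows at least like a positive power of k, so its logarithm eventually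
    exceeds a multiple of ln k, and the terms are of order at most 1 / (k (ln k)^(1 + eps)). The
    value [D] enters only finitely many terms. *)
Lemma drift_sum_bounded (m c eps x1 D : R) : 0 < m -> 0 < c -> 0 < eps ->
  exists C, forall n, \sum_(k < n)
    (if x1 <= min_threshold m k then c / ln (min_threshold m k) `^ (1 + eps) else D)
      * (beta / k.+1%:R) <= C.
Proof.
move=> m0 c0 e0; have [a a0 ha] := min_threshold_ge m0.
have b0 : 0 < beta by rewrite (lt_trans ltr01).
(* Half of the exponent is kept; the other half absorbs the constant [a] once k is large. *)
pose th := (beta - 1) / 2.
have th0 : 0 < th by rewrite divr_gt0 ?subr_gt0.
have [k1 hk1] := powR_nat_unbounded a^-1 th0.
have [k2 hk2] : exists k0, forall k, (k0 <= k)%N -> x1 / a <= k.+1%:R `^ (beta - 1).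
  by apply: powR_nat_unbounded; rewrite subr_gt0.
pose C' := beta * (c / th `^ (1 + eps)).
pose u k := (if x1 <= min_threshold m k then
  c / ln (min_threshold m k) `^ (1 + eps) else D) * (beta / k.+1%:R).
(* From this index on [ln k] is positive, the constant [a] is absorbed ([k1]), and the threshold has
   passed [x1] ([k2]). *)
apply: (@sum_le_of_telescope R u
  (fun k => C' / eps * (ln k%:R `^ (- eps))) (maxn 2 (maxn k1 k2))).
  move=> k; rewrite mulr_ge0 ?powR_ge0// divr_ge0 ?(ltW e0)//.
  by rewrite mulr_ge0 ?(ltW b0)// divr_ge0 ?powR_ge0 ?(ltW c0).
move=> k; rewrite !geq_max => /and3P[k2' kk1 kk2].
have lk := ha k.
have q0 : (0 : R) < k.+1%:R `^ th by rewrite powR_gt0.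
have qq : k.+1%:R `^ (beta - 1) = k.+1%:R `^ th * k.+1%:R `^ th :> R.
  rewrite -powRD; last by rewrite pnatr_eq0 implybT.
  by congr (_ `^ _); rewrite /th; field.
have lx1 : x1 <= min_threshold m k.
  apply: le_trans lk; rewrite mulrC -ler_pdivrMr//; exact: hk2.
have lth : k.+1%:R `^ th <= min_threshold m k.
  apply: le_trans lk; rewrite qq mulrA ler_peMl ?(ltW q0)//.
  by rewrite -ler_pdivrMl// mulr1; exact: hk1.
rewrite /u lx1.
have k0 : (0 : R) < k.+1%:R by rewrite ltr0n.
have lnk : 0 < ln k%:R :> R by rewrite ln_gt0// ltr1n.
have lnS : 0 < ln k.+1%:R :> R by rewrite ln_gt0// ltr1n ltnS ltnW.
have lnl : th * ln k.+1%:R <= ln (min_threshold m k).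
  by rewrite -ln_powR ler_ln ?posrE// (lt_le_trans q0).
have t0 : 0 < th * ln k.+1%:R by rewrite mulr_gt0.
have p1 : 0 < (th * ln k.+1%:R) `^ (1 + eps) by rewrite powR_gt0.
apply: (@le_trans _ _ (c / (th * ln k.+1%:R) `^ (1 + eps) * (beta / k.+1%:R))).
  rewrite ler_pM2r ?divr_gt0// ler_pM2l// lef_pV2 ?posrE//; last first.
    by rewrite powR_gt0// (lt_le_trans t0).
  apply: ge0_ler_powR; rewrite ?nnegrE ?(ltW t0)//.
  - by rewrite addr_ge0// ltW.
  - by rewrite (le_trans (ltW t0)).
rewrite powRM ?(ltW th0) ?(ltW lnS)//.
have T0 : 0 < th `^ (1 + eps) by rewrite powR_gt0.
have L0 : 0 < ln k.+1%:R `^ (1 + eps) :> R by rewrite powR_gt0.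
rewrite -mulrBr.
have step := @powRN_diff R eps (ln k%:R) (ln k.+1%:R) e0 lnk.
have kk : k.-1.+1 = k by apply: ltn_predK k2'.
have dk : k.+1%:R^-1 <= ln k.+1%:R - ln k%:R :> R.
  by have := @ln_nat_diff R k.-1; rewrite kk.
have lnle : ln k%:R <= ln k.+1%:R :> R.
  by rewrite -subr_ge0 (le_trans _ dk)// invr_ge0 ltW.
have {}step := step lnle.
have C0 : 0 < C' / eps by rewrite divr_gt0// /C' mulr_gt0// divr_gt0.
apply: (@le_trans _ _ (C' / eps * (eps * k.+1%:R^-1 / ln k.+1%:R `^ (1 + eps)))).
  rewrite /C'; move: T0 L0 k0 e0; clear.
  move: (th `^ _) => t; move: ((ln _) `^ _) => l; move: (_.+1%:R) => n t0 l0 n0 e0.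
  rewrite le_eqVlt; apply/orP; left; apply/eqP; field.
  by rewrite !gt_eqF.
rewrite ler_pM2l//; apply: le_trans step.
by rewrite ler_pM2r ?invr_gt0// ler_pM2l.
Qed.

End drift.

(** The function is dominated by the series of its steps, integrated term by term. Neighbouring
    steps share an endpoint, which a majorant tolerates. *)
Lemma integral_le_steps (R : realType) (l c : nat -> R) (C : R) (f : R -> \bar R) :
  (forall k, l k <= l k.+1) -> (forall x, exists k, x < l k) ->
  (forall k, 0 <= c k) ->
  (forall x, l 0%N <= x -> (0 <= f x)%E) ->
  (forall k x, l k <= x -> x <= l k.+1 -> (f x <= (c k)%:E)%E) ->
  (forall n, \sum_(k < n) c k * (l k.+1 - l k) <= C) ->
  (\int[lebesgue_measure]_(x in `[l 0%N, +oo[) f x <= C%:E)%E.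
Proof.
move=> l_nd l_oo c0 f0 fc sumC.
pose h k (x : R) := (c k * \1_(`[l k, l k.+1]%classic) x)%:E.
have h0 k x : (0 <= h k x)%E by rewrite lee_fin mulr_ge0.
have mh k : measurable_fun setT (h k).
  by apply/measurable_EFinP; apply: measurable_funM => //; exact: measurable_indic.
rewrite integral_mkcond.
apply: (@le_trans _ _ (\int[lebesgue_measure]_x \sum_(0 <= k <oo) h k x)%E).
  apply: ge0_le_integral_nonmeasurable => x.
    by apply: erestrict_ge0 => y /=; rewrite in_itv/= andbT; exact: f0.
  rewrite patchE; case: ifPn => [|_]; last exact: nneseries_ge0.
  rewrite inE/= in_itv/= andbT => l0x.
  have [k lk kx] : exists2 k, l k <= x & x <= l k.+1.
    have [n nx] := l_oo x; elim: n nx => [|n IH nx]; first by rewrite ltNge l0x.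
    have [/IH//|lnx] := ltP x (l n).
    by exists n => //; exact: ltW.
  apply: (le_trans (fc _ _ lk kx)).
  apply: (@le_trans _ _ (\sum_(0 <= i < k.+1) h i x)%E); last first.
    by apply: nneseries_lim_ge => *; exact: h0.
  rewrite big_nat_recr//= {2}/h indicE mem_set/= ?in_itv/= ?lk// mulr1.
  by rewrite leeDr// sume_ge0.
rewrite integral_nneseries//.
apply: lime_le; first by apply: is_cvg_nneseries => k _ _; exact: integral_ge0.
apply: nearW => n; rewrite big_mkord.
rewrite (_ : (\sum_(i < n) _)%E = (\sum_(k < n) c k * (l k.+1 - l k))%:E).
  by rewrite lee_fin.
rewrite -sumEFin; apply: eq_bigr => k _.
rewrite /h; under eq_integral do rewrite EFinM.
rewrite ge0_integralZl_EFin//; last first.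
  by apply/measurable_EFinP; exact: measurable_indic.
rewrite integral_indic//= setIT lebesgue_measure_itv/= lte_fin.
have := l_nd k; rewrite le_eqVlt => /predU1P[->|lk].
  by rewrite ltxx subrr mulr0 mule0.
by rewrite lk -EFinD -EFinM.
Qed.

(** * The selection of independent, identically distributed variables *)

Section iid.
Context d (Omega : measurableType d) (R : realType) (P : probability Omega R).
Variables (X : nat -> {RV P >-> R}) (F : R -> R).
Hypothesis X_ge0 : forall i w, 0 <= X i w.
Hypothesis X_indep : mutually_independent X.
Hypothesis X_cdf : forall i x, cdf (X i) x = (F x)%:E.
Hypothesis F_lt1 : forall x, 0 < 1 - F x.

Let law : probability R R := distribution P (X 0%N).

Lemma law_eq i A : measurable A -> distribution P (X i) A = law A.
Proof.
apply: probability_eq_itvNyc => x.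
by transitivity (F x)%:E; [exact: X_cdf|apply/esym; exact: X_cdf].
Qed.

Lemma integral_law i (g : R -> \bar R) :
  (\int[distribution P (X i)]_y g y = \int[law]_y g y)%E.
Proof. by apply: eq_measure_integral => A mA _; exact: law_eq. Qed.

Lemma law_itvNyc x : law `]-oo, x]%classic = (F x)%:E.
Proof. exact: (X_cdf 0%N x). Qed.

Lemma law_itvoy x : law `]x, +oo[%classic = (1 - F x)%:E.
Proof.
rewrite -setCitvl EFinB -law_itvNyc.
exact: probability_setC.
Qed.

Lemma F_ge0 x : 0 <= F x.
Proof. by rewrite -lee_fin -law_itvNyc. Qed.

Lemma F_homo x y : x <= y -> F x <= F y.
Proof. by move=> xy; rewrite -lee_fin -!(X_cdf 0%N); exact: cdf_nondecreasing. Qed.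

(** For fixed [N] and [n], the absence of a later value above [N] has probability at most
    [F N%:R ^+ k] for every [k], by independence of a block of [k] observations; hence 0. Off this
    null set every search for the next selection succeeds. *)
Lemma ae_unbounded :
  {ae P, forall w, forall N n : nat, exists2 i, (n < i)%N & N%:R < X i w}.
Proof.
apply: ae_foralln => N; apply: ae_foralln => n.
pose E := \bigcap_(i in [set i | (n < i)%N]) (X i @^-1` `]-oo, N%:R]%classic).
have mX i : measurable (X i @^-1` `]-oo, N%:R]%classic).
  by rewrite -[X in measurable X]setTI; exact: measurable_funP.
have mE : measurable E by apply: bigcap_measurable => //; exists n.+1 => /=.
exists E; split => //; last first.
  move=> w /= nw i /= ni; rewrite in_itv/= leNgt; apply/negP => Nx.
  by apply: nw; exists i.
have PE k : (P E <= (F N%:R ^+ k)%:E)%E.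
  pose J := seq_fset tt (iota n.+1 k).
  have memJ j : (j \in J) = (n < j <= n + k)%N.
    by rewrite seq_fsetE mem_iota addSn ltnS.
  have := X_indep (J := J) (A := fun=> `]-oo, N%:R]%classic) (fun _ _ => measurable_itv _).
  rewrite (eq_bigr (fun=> (F N%:R)%:E)); last by move=> j _; exact: (X_cdf j N%:R).
  rewrite big_const_seq count_predT size_seq_fset undup_id ?iota_uniq// size_iota.
  have -> : iter k (mule (F N%:R)%:E) 1%E = (F N%:R ^+ k)%:E.
    by elim: k {J memJ} => //= k ->; rewrite -EFinM exprS.
  move=> <-; apply: le_measure; rewrite ?inE//.
    by apply: fin_bigcap_measurable.
  by move=> w Ew j /=; rewrite memJ => /andP[nj _]; exact: Ew.
apply/eqP; rewrite eq_le measure_ge0 andbT.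
have FN : `|F N%:R| < 1 by rewrite ger0_norm ?F_ge0// -subr_gt0.
have : (F N%:R ^+ k)%:E @[k --> \oo] --> 0%:E.
  by apply: cvg_EFin; [exact: nearW|exact: cvg_expr].
move=> cv; apply: (@le_trans _ _ (limn (fun k => (F N%:R ^+ k)%:E))).
  by apply: lime_ge; [apply/cvg_ex; exists 0%E|exact: nearW].
by rewrite (cvg_lim _ cv).
Qed.

(** * Expected overshoot of a level *)

(** The stop-loss transform E(X - v)^+; divided by A_(K + 1) it is the mean one-step increase of the
    normalized sum at threshold [v]. *)
Definition excess (v : R) : \bar R := (\int[law]_y (Num.max (y - v) 0)%:E)%E.

Lemma measurable_pos_part (v : R) : measurable_fun setT (fun y : R => Num.max (y - v) 0).
Proof. by apply: measurable_maxr => //; exact: measurable_funB. Qed.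

Lemma excess_ge0 v : (0 <= excess v)%E.
Proof. by apply: integral_ge0 => y _; rewrite lee_fin le_max lexx orbT. Qed.

Lemma excessE v :
  excess v = (mean_residual_life P (X 0%N) v * (1 - F v)%:E)%E.
Proof.
have PA : P [set w | v < X 0%N w] = (1 - F v)%:E.
  rewrite -law_itvoy; congr (P _); apply/seteqP; split => w /=; by rewrite in_itv/= andbT.
rewrite /mean_residual_life /event_expectation PA.
rewrite -muleA inver gt_eqF// -EFinM mulVf ?gt_eqF// mule1.
rewrite /excess ge0_integral_distribution//; last 2 first.
- by apply/measurable_EFinP; exact: measurable_pos_part.
- by move=> y; rewrite lee_fin le_max lexx orbT.
rewrite [RHS]integral_mkcond; apply: eq_integral => w _ /=.
rewrite patchE; case: ifPn => [|]; rewrite ?inE ?notin_setE/=.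
  by move=> vX; rewrite max_l// subr_ge0 ltW.
by move=> /negP; rewrite -leNgt => vX; rewrite max_r// subr_le0.
Qed.

Lemma excess0 : excess 0 = 'E_P[X 0%N]%E.
Proof.
rewrite unlock /excess ge0_integral_distribution//; last 2 first.
- by apply/measurable_EFinP; exact: measurable_pos_part.
- by move=> y; rewrite lee_fin le_max lexx orbT.
by apply: eq_integral => w _ /=; rewrite subr0 max_l.
Qed.

Lemma excess_le0 v : 0 <= v -> (excess v <= excess 0)%E.
Proof.
move=> v0; apply: ge0_le_integral_nonmeasurable => y.
  by rewrite lee_fin le_max lexx orbT.
by rewrite lee_fin ge_max !le_max lexx orbT subr0 gerBl v0.
Qed.

(** Since y^+ <= (y - v)^+ + v for v >= 0, a finite overshoot at one level gives a finite mean. *)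
Lemma excess0_le v : 0 <= v -> (excess 0 <= excess v + v%:E)%E.
Proof.
move=> v0.
have -> : v%:E = (\int[law]_y (cst v%:E) y)%E.
  transitivity (v%:E * law setT)%E; last by apply/esym; exact: integral_cst.
  by transitivity (v%:E * 1)%E; [rewrite mule1|congr (_ * _)%E; apply/esym; exact: probability_setT].
rewrite -ge0_integralD//; last 2 first.
- by move=> y _; rewrite lee_fin le_max lexx orbT.
- by apply/measurable_EFinP; exact: measurable_pos_part.
apply: ge0_le_integral_nonmeasurable => y.
  by rewrite lee_fin le_max lexx orbT.
by rewrite -EFinD lee_fin subr0 ge_max -lerBlDr le_max lexx addr_ge0// le_max lexx orbT.
Qed.

(** Both drift estimates integrate, over the next observation, a function that is constant up to the
    threshold and affine beyond it. *)
Lemma integral_excess (a b c v : R) : 0 <= a -> 0 <= b -> 0 <= c ->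
  (\int[law]_y (if v < y then b + c * (y - v) else a)%:E =
   (a * F v + b * (1 - F v))%:E + c%:E * excess v)%E.
Proof.
move=> a0 b0 c0.
have -> : (\int[law]_y (if v < y then b + c * (y - v) else a)%:E =
  \int[law]_y ((a * \1_(`]-oo, v]%classic) y)%:E + (b * \1_(`]v, +oo[%classic) y)%:E
    + (c%:E * (Num.max (y - v) 0)%:E)))%E.
  apply: eq_integral => y _; rewrite -EFinM -!EFinD; congr _%:E.
  rewrite !indicE !mem_setE !in_itv/= andbT.
  case: ltP => vy; rewrite ?mulr0 ?mulr1 ?add0r ?addr0.
    by rewrite max_l// subr_ge0 ltW.
  by rewrite max_r ?subr_le0// mulr0 addr0.
have mE : measurable_fun setT (fun y : R => (Num.max (y - v) 0)%:E).
  by apply/measurable_EFinP; exact: measurable_pos_part.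
have mi (A : set R) (r : R) : measurable A ->
    measurable_fun setT (fun y : R => (r * \1_A y)%:E).
  by move=> mA; apply/measurable_EFinP; apply: measurable_funM.
have ii (A : set R) (r : R) : measurable A -> 0 <= r ->
    (\int[law]_y (r * \1_A y)%:E = r%:E * law A)%E.
  move=> mA r0; under eq_integral do rewrite EFinM.
  rewrite ge0_integralZl_EFin//; last first.
    by apply/measurable_EFinP; exact: measurable_indic.
  by rewrite integral_indic// setIT.
rewrite ge0_integralD//; last 4 first.
- by move=> y _; rewrite adde_ge0// lee_fin mulr_ge0.
- by apply: emeasurable_funD; exact: mi.
- by move=> y _; rewrite mule_ge0// lee_fin le_max lexx orbT.
- exact: measurable_funeM.
rewrite ge0_integralD//; last 4 first.
- by move=> y _; rewrite lee_fin mulr_ge0.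
- exact: mi.
- by move=> y _; rewrite lee_fin mulr_ge0.
- exact: mi.
rewrite !ii// law_itvNyc law_itvoy -!EFinM -EFinD ge0_integralZl_EFin//.
by move=> y _; rewrite lee_fin le_max lexx orbT.
Qed.

(** * One-step drift of the selection chain *)

Variable beta : R.
Hypothesis beta_gt1 : 1 < beta.

Let beta_ge1 : 1 <= beta. Proof. exact: ltW. Qed.
Let beta_gt0 : 0 < beta. Proof. exact: lt_trans beta_gt1. Qed.
Let g_gt0 k : 0 < growth beta k. Proof. by apply: growth_gt0; exact: ltW. Qed.

Definition selection (i : nat) (w : Omega) : nat * R * R :=
  chain X (@select_init R) (select_step beta) i w.

Let U := selection.
Let M u := normalized_sum beta u.

Lemma measurable_selection i : measurable_fun setT (U i).
Proof.
apply: measurable_chain; first exact: measurable_select_init.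
exact: measurable_select_step.
Qed.

Let mM : measurable_fun setT M. Proof. exact: measurable_normalized_sum. Qed.

Lemma selectionS i w : U i.+1 w = select_step beta (U i w, X i.+1 w).
Proof. by []. Qed.

Lemma selection_first i w : (U i w).2 = X 0%N w.
Proof. exact: run_first. Qed.

Lemma selection_ge_first i w : X 0%N w <= M (U i w).
Proof. exact: (normalized_sum_ge_first beta_ge1). Qed.

Lemma selection_homo i j w : (i <= j)%N -> M (U i w) <= M (U j w).
Proof. exact: (normalized_sum_homo beta_ge1). Qed.

Lemma selection_ge0 i w : 0 <= M (U i w).
Proof. exact: le_trans (selection_ge_first i w). Qed.

Lemma min_threshold_le m u : m <= M u ->
  min_threshold beta m u.1.1 <= threshold beta u.
Proof.
move=> mu; rewrite (thresholdE beta_ge1) /min_threshold ler_pM2l//.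
by rewrite mulr_gt0// divr_gt0.
Qed.

Lemma integral_next i (psi : (nat * R * R) * R -> \bar R) :
  measurable_fun setT psi -> (forall z, 0 <= psi z)%E ->
  (\int[P]_w psi (U i w, X i.+1 w) = \int[P]_w \int[law]_y psi (U i w, y))%E.
Proof.
move=> mpsi psi0.
rewrite (integral_chain_next measurable_select_init
  (measurable_select_step beta) X_indep i mpsi psi0).
by apply: eq_integral => w _; exact: integral_law.
Qed.

Definition weighted (m : R) (D : nat -> R) (u : nat * R * R) : R :=
  if m <= u.2 then M u / D u.1.1 else 0.

Lemma measurable_weighted m D : measurable_fun setT (weighted m D).
Proof.
apply: measurable_fun_ifT => //; first by apply: measurable_fun_ler.
apply: measurable_funM => //.
exact: (@measurable_comp_count _ _ R (fun k => (D k)^-1)).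
Qed.

(** At threshold V a selection has probability 1 - F V. Given one, dividing by the next [D] must
    outweigh the mean overshoot, at most delta V, divided by A_(k + 1). With q = beta / (k + 1), V /
    A_(k + 1) is M q / (1 + q) <= M q, so the factor 1 + delta q is enough. *)
Lemma weighted_supermartingale (m : R) (delta D : nat -> R) :
  0 < m -> (forall k, 0 < D k) -> (forall k, 0 <= delta k) ->
  (forall k, D k * (1 + delta k * (beta / k.+1%:R)) <= D k.+1) ->
  (forall k v, min_threshold beta m k <= v ->
    (excess v <= (delta k * v * (1 - F v))%:E)%E) ->
  forall i, (\int[P]_w (weighted m D (U i w))%:E <= (D 0%N)^-1%:E * excess 0)%E.
Proof.
move=> m0 D0 d0 DD hexc; elim=> [|i IH].
  rewrite excess0 unlock -ge0_integralZl_EFin//; last 3 first.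
  - by move=> w _; rewrite lee_fin.
  - exact/measurable_EFinP.
  - by rewrite invr_ge0 ltW.
  apply: ge0_le_integral_nonmeasurable => w; rewrite -?EFinM lee_fin /weighted /=.
    by case: ifP => // _; rewrite divr_ge0 ?(ltW (D0 _))// (selection_ge0 0).
  case: ifP => _; last by rewrite mulr_ge0// invr_ge0 ltW.
  by rewrite /M /normalized_sum /= growth0 divr1 mulrC.
apply: le_trans IH.
(* The absolute value makes [psi] nonnegative on all states, also those with a negative total; it
   changes nothing on reached states. *)
pose psi (z : (nat * R * R) * R) := (`|weighted m D (select_step beta z)|)%:E.
have w0 j w : 0 <= weighted m D (U j w).
  by rewrite /weighted; case: ifP => // _; rewrite divr_ge0 ?selection_ge0// ltW.
rewrite (_ : (\int[P]_w (weighted m D (U i.+1 w))%:E =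
    \int[P]_w psi (U i w, X i.+1 w))%E); last first.
  by apply: eq_integral => w _; rewrite /psi -selectionS ger0_norm.
rewrite integral_next; last 2 first.
- apply/measurable_EFinP; apply: measurableT_comp => //.
  apply: (measurableT_comp (measurable_weighted m D)).
  exact: measurable_select_step.
- by move=> z; rewrite lee_fin.
apply: ge0_le_integral_nonmeasurable => w.
  by apply: integral_ge0 => y _; rewrite lee_fin.
have Ufst := selection_first i w.
have := selection_ge0 i w; have := selection_ge_first i w.
move: (U i w) Ufst => u u2 Mu1 Mu0.
have [mu|mu] := leP m u.2; last first.
  rewrite (_ : (\int[law]_y psi (u, y))%E = 0%E).
    by rewrite /weighted [m <= _]leNgt mu.
  apply: integral0_eq => y _; rewrite /psi /weighted.
  have -> : (select_step beta (u, y)).2 = u.2.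
    by rewrite /select_step /=; case: ifP.
  by rewrite [m <= _]leNgt mu normr0.
set V := threshold beta u.
set k := u.1.1.
have mV : min_threshold beta m k <= V.
  by apply: min_threshold_le; rewrite (le_trans mu)// u2.
rewrite (_ : (\int[law]_y psi (u, y) =
  \int[law]_y (if (V < y)%R then M u / D k.+1 +
    (growth beta k.+1 * D k.+1)^-1 * (y - V) else M u / D k)%:E)%E); last first.
  apply: eq_integral => y _; rewrite /psi /weighted.
  have -> : (select_step beta (u, y)).2 = u.2.
    by rewrite /select_step /=; case: ifP.
  rewrite mu /M normalized_sum_step// count_step -/V -/k -/(M u).
  case: ltP => Vy; rewrite ?addn1 ?addn0.
    rewrite max_l ?subr_ge0 ?(ltW Vy)// ger0_norm; last first.
      rewrite divr_ge0 ?(ltW (D0 _))// addr_ge0// divr_ge0 ?(ltW (g_gt0 _))//.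
      by rewrite subr_ge0 ltW.
    congr _%:E; rewrite mulrDl; congr (_ + _).
    by rewrite -mulrA -invfM mulrC.
  by rewrite max_r ?subr_le0// mul0r addr0 ger0_norm// divr_ge0// ltW.
rewrite integral_excess; last 3 first.
- by rewrite divr_ge0// ltW.
- by rewrite divr_ge0// ltW.
- by rewrite invr_ge0 mulr_ge0// ltW.
set c := (_ * _)^-1.
have c0 : 0 <= c by rewrite /c invr_ge0 mulr_ge0// ltW.
apply: (@le_trans _ _ ((M u / D k * F V + M u / D k.+1 * (1 - F V))%:E +
   c%:E * (delta k * V * (1 - F V))%:E)%E).
  by rewrite leeD2l// lee_wpmul2l ?lee_fin//; exact: hexc.
rewrite /weighted mu -/k -EFinM -EFinD lee_fin -addrA.
(* The share [F V] of no selection contributes equally to both sides; what remains carries the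
   common factor 1 - F V. *)
suff h : M u / D k.+1 + c * (delta k * V) <= M u / D k.
  have FV := F_lt1 V; nra.
pose q := beta / k.+1%:R.
have q0 : 0 < q by rewrite divr_gt0.
have VE : V = q * growth beta k * M u by rewrite /V (thresholdE beta_ge1).
have cE : c * (delta k * V) = M u / D k.+1 * (delta k * (q / (1 + q))).
  rewrite /c VE growthS -/q; have := g_gt0 k; have := D0 k.+1.
  move: (growth _ _) (D _) => g e e0 gg0; field.
  by rewrite !gt_eqF// addr_gt0.
rewrite cE -[X in X + _]mulr1 -mulrDr -[X in X <= _]mulrA; apply: ler_wpM2l => //.
rewrite ler_pdivrMl// ler_pdivlMr// (le_trans _ (DD k))// mulrC ler_pM2l//.
rewrite lerD2l ler_wpM2l// -/q ler_pdivrMr ?addr_gt0//.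
by rewrite mulrDr mulr1 lerDl mulr_ge0// ltW.
Qed.

(** When X_0 >= m, a selection made at count k credits g k / A_(k + 1) on the left. The mean
    increase of [M] at that step, the overshoot of the threshold V over A_(k + 1), is at least this
    credit times the probability 1 - F V of a selection. *)
Lemma drift_lower_bound (m : R) (g : nat -> R) :
  0 < m -> (forall k, 0 <= g k) ->
  (forall k v, min_threshold beta m k <= v ->
    ((g k * (1 - F v))%:E <= excess v)%E) ->
  forall i, (\int[P]_w (if (m <= X 0%N w)%R then
      \sum_(k < (U i w).1.1) g k / growth beta k.+1 else 0)%:E <=
    \int[P]_w (M (U i w))%:E)%E.
Proof.
move=> m0 g0 hexc.
pose G n := \sum_(k < n) g k / growth beta k.+1.
have gg0 k : 0 <= g k / growth beta k.+1 by rewrite divr_ge0// ltW.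
have G0 n : 0 <= G n by apply: sumr_ge0.
pose H (u : nat * R * R) : R := if m <= u.2 then G u.1.1 else 0.
have mH : measurable_fun setT H.
  apply: measurable_fun_ifT => //; first by apply: measurable_fun_ler.
  exact: (@measurable_comp_count _ _ R G).
have H0 u : 0 <= H u by rewrite /H; case: ifP.
move=> i; rewrite (_ : (\int[P]_w _ = \int[P]_w (H (U i w))%:E)%E); last first.
  by apply: eq_integral => w _; rewrite /H selection_first.
elim: i => [|i IH].
  apply: ge0_le_integral_nonmeasurable => w; rewrite lee_fin//.
  rewrite {1}/H /= /G big_ord0; case: ifP => _; exact: (selection_ge0 0).
have mU := measurable_selection i.
(* [psi1] and [psi2] are the one-step increments of [H] and of [M]. *)
pose psi1 (z : (nat * R * R) * R) : R :=
  if (m <= z.1.2) && (threshold beta z.1 < z.2)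
  then g z.1.1.1 / growth beta z.1.1.1.+1 else 0.
pose psi2 (z : (nat * R * R) * R) : R :=
  Num.max (z.2 - threshold beta z.1) 0 / growth beta z.1.1.1.+1.
have psi10 z : 0 <= psi1 z by rewrite /psi1; case: ifP.
have psi20 z : 0 <= psi2 z.
  by rewrite /psi2 divr_ge0 ?(ltW (g_gt0 _))// le_max lexx orbT.
have mth : measurable_fun setT (fun z : (nat * R * R) * R => threshold beta z.1).
  by apply: (measurableT_comp (measurable_threshold beta)).
have mcount (f : nat -> R) : measurable_fun setT (fun z : (nat * R * R) * R => f z.1.1.1).
  by apply: (measurableT_comp (measurable_comp_count f)).
have mpsi1 : measurable_fun setT psi1.
  apply: measurable_fun_ifT => //; last exact: (mcount (fun k => g k / growth beta k.+1)).
  apply: measurable_and; last exact: measurable_fun_ltr.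
  by apply: measurable_fun_ler => //; apply: measurableT_comp.
have mpsi2 : measurable_fun setT psi2.
  apply: measurable_funM; last exact: (mcount (fun k => (growth beta k.+1)^-1)).
  by apply: measurable_maxr => //; apply: measurable_funB.
have mUX : measurable_fun setT (fun w => (U i w, X i.+1 w)).
  exact: measurable_fun_pair.
rewrite (_ : (\int[P]_w (H (U i.+1 w))%:E = \int[P]_w (H (U i w))%:E +
    \int[P]_w (psi1 (U i w, X i.+1 w))%:E)%E); last first.
  rewrite -ge0_integralD//; last 4 first.
  - by move=> w _; rewrite lee_fin.
  - by apply/measurable_EFinP; exact: measurableT_comp.
  - by move=> w _; rewrite lee_fin.
  - by apply/measurable_EFinP; exact: (measurableT_comp mpsi1).
  apply: eq_integral => w _; rewrite -EFinD; congr _%:E.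
  rewrite /H selection_first selectionS /psi1 /= selection_first.
  rewrite count_step; case: ifP => //= _; last by rewrite addr0.
  case: ifP => _; rewrite ?addn0 ?addr0// addn1.
  by rewrite /G big_ord_recr.
rewrite (_ : (\int[P]_w (M (U i.+1 w))%:E = \int[P]_w (M (U i w))%:E +
    \int[P]_w (psi2 (U i w, X i.+1 w))%:E)%E); last first.
  rewrite -ge0_integralD//; last 4 first.
  - by move=> w _; rewrite lee_fin selection_ge0.
  - by apply/measurable_EFinP; exact: measurableT_comp.
  - by move=> w _; rewrite lee_fin.
  - by apply/measurable_EFinP; exact: (measurableT_comp mpsi2).
  apply: eq_integral => w _; rewrite -EFinD selectionS; congr _%:E.
  by rewrite /M normalized_sum_step.
apply: leeD => //.
rewrite (@integral_next i (fun z => (psi1 z)%:E))//; last exact/measurable_EFinP.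
rewrite (@integral_next i (fun z => (psi2 z)%:E))//; last exact/measurable_EFinP.
apply: ge0_le_integral_nonmeasurable => w.
  by apply: integral_ge0 => y _; rewrite lee_fin.
have := selection_first i w; have := selection_ge_first i w.
move: (U i w) => u Mu1 u2.
have [mu|mu] := leP m u.2; last first.
  rewrite (_ : (\int[law]_y (psi1 (u, y))%:E)%E = 0%E).
    by apply: integral_ge0 => y _; rewrite lee_fin.
  by apply: integral0_eq => y _; rewrite /psi1 [m <= _]leNgt mu.
set V := threshold beta u; set k := u.1.1.
have mV : min_threshold beta m k <= V.
  by apply: min_threshold_le; rewrite (le_trans mu)// u2.
have A0 : 0 <= (growth beta k.+1)^-1 by rewrite invr_ge0 ltW.
rewrite (_ : (\int[law]_y (psi1 (u, y))%:E =
  \int[law]_y (if (V < y)%R then g k / growth beta k.+1 + 0 * (y - V) else 0)%:E)%E);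
  last by apply: eq_integral => y _; rewrite /psi1 mu/= mul0r addr0.
rewrite (_ : (\int[law]_y (psi2 (u, y))%:E =
  \int[law]_y (if (V < y)%R then 0 + (growth beta k.+1)^-1 * (y - V) else 0)%:E)%E);
  last first.
  apply: eq_integral => y _; rewrite /psi2 /= -/V -/k; congr _%:E.
  case: ltP => Vy; first by rewrite max_l ?subr_ge0 ?(ltW Vy)// add0r mulrC.
  by rewrite max_r ?subr_le0// mul0r.
rewrite !integral_excess// !mul0r !add0r.
have z : 0%:E = 0%E :> \bar R by [].
rewrite z mul0e adde0 mulrAC mulrC EFinM; apply: lee_wpmul2l; first by rewrite lee_fin.
exact: hexc.
Qed.

(** * Bounds drawn from the mean residual life *)

Let f (v : R) : \bar R := mean_residual_life P (X 0%N) v.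

Lemma mean_residual_life_ge0 v : (0 <= f v)%E.
Proof.
rewrite /f /mean_residual_life /event_expectation; apply: mule_ge0.
  by apply: integral_ge0 => w /= vX; rewrite lee_fin subr_ge0 ltW.
by rewrite inve_ge0.
Qed.

Lemma mean_residual_life_fin_num v : 0 <= v -> (excess 0 < +oo)%E ->
  f v \is a fin_num.
Proof.
move=> v0 e0; rewrite ge0_fin_numE ?mean_residual_life_ge0//.
have := le_lt_trans (excess_le0 v0) e0; rewrite excessE -/(f v).
case: (f v) => [r _| |]; rewrite ?ltry//.
by rewrite gt0_mulye// lte_fin.
Qed.

(** For beta >= 1 the growth factor is at least the product of the (j + 2) / (j + 1), which is k +
    1. *)
Lemma self_le_min_threshold m k : 0 < m -> m <= min_threshold beta m k.
Proof.
move=> m0; rewrite /min_threshold ler_peMl ?(ltW m0)//.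
have h : k.+1%:R <= growth beta k.
  elim: k => [|k IH]; first by rewrite growth0.
  rewrite growthS mulrDr mulr1 -natr1; apply: lerD => //.
  rewrite mulrA ler_pdivlMr ?ltr0n// mul1r (le_trans IH)//.
  by rewrite ler_peMr// ltW.
rewrite -mulrA (le_trans beta_ge1)// ler_peMr ?(ltW beta_gt0)//.
by rewrite ler_pdivlMl ?ltr0n// mulr1.
Qed.

Lemma excess0_lty c eps :
  (\forall x \near +oo, (f x < (c * x / ln x `^ (1 + eps))%:E)%E) ->
  (excess 0 < +oo)%E.
Proof.
move=> [x0 [_ hx]]; pose v := Num.max (x0 + 1) 0.
have v0 : 0 <= v by rewrite le_max lexx orbT.
apply: (le_lt_trans (excess0_le v0)).
have /hx fv : x0 < v by rewrite lt_max ltrDl ltr01.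
rewrite lte_add_pinfty ?ltry// excessE.
rewrite lte_mul_pinfty ?mean_residual_life_ge0 ?ltry//.
by rewrite ge0_fin_numE ?mean_residual_life_ge0// (lt_trans fv) ?ltry.
Qed.

(** Where ln v >= 1, c / (ln v)^(1 + eps) decreases, so its value at the least threshold serves
    every higher threshold. Counts whose least threshold lies below [x1] get a constant instead. *)
Lemma drift_bound c eps m : 0 < c -> 0 < eps -> 0 < m ->
  (\forall x \near +oo, (f x < (c * x / ln x `^ (1 + eps))%:E)%E) ->
  exists delta : nat -> R, [/\ forall k, 0 <= delta k,
    exists C, forall n, \sum_(k < n) delta k * (beta / k.+1%:R) <= C &
    forall k v, min_threshold beta m k <= v ->
      (excess v <= (delta k * v * (1 - F v))%:E)%E].
Proof.
move=> c0 e0 m0 hf.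
have e0oo := excess0_lty hf.
have [x0 [_ hx]] := hf.
(* Beyond [x1] both the bound on [f] and [1 <= ln v] hold. *)
pose x1 := Num.max (x0 + 1) (expR 1).
have x1e : expR 1 <= x1 by rewrite le_max lexx orbT.
have ln1 v : x1 <= v -> 1 <= ln v.
  move=> xv; rewrite -[leLHS]expRK ler_ln ?posrE ?expR_gt0//.
    exact: le_trans xv.
  by rewrite (lt_le_trans (expR_gt0 1))// (le_trans x1e).
have ex v : x1 <= v -> (excess v <= (c / ln v `^ (1 + eps) * v * (1 - F v))%:E)%E.
  move=> xv; rewrite excessE EFinM; apply: lee_wpmul2r.
    by rewrite lee_fin ltW.
  rewrite mulrAC; apply/ltW/hx/(lt_le_trans _ xv).
  by rewrite lt_max ltrDl ltr01.
pose E0 := fine (excess 0).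
have E0E : excess 0 = E0%:E by rewrite fineK// ge0_fin_numE// excess_ge0.
have E00 : 0 <= E0 by rewrite fine_ge0// excess_ge0.
(* The first entry covers v >= x1, where the power of ln v is at least 1. The second covers m <= v <
   x1, where the overshoot is at most the mean [E0] while 1 - F v >= 1 - F x1. *)
pose D := Num.max c (E0 / (1 - F x1) / m).
have D0 : 0 <= D by rewrite le_max (ltW c0).
pose lo := min_threshold beta m.
exists (fun k => if x1 <= lo k then c / ln (lo k) `^ (1 + eps) else D); split.
- by move=> k; case: ifP => // _; rewrite divr_ge0 ?powR_ge0// ltW.
- exact: drift_sum_bounded.
move=> k v; rewrite -/(lo k) => lv.
have mv : m <= v by apply: le_trans lv; exact: self_le_min_threshold.
have v0 : 0 < v by exact: lt_le_trans mv.
have F0 := F_lt1 v.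
have [xv|vx] := leP x1 v; last first.
  rewrite ifF; last by apply/negbTE; rewrite -ltNge (le_lt_trans lv).
  apply: (le_trans (excess_le0 (ltW v0))); rewrite E0E lee_fin.
  have F1 := F_lt1 x1.
  have -> : E0 = E0 / (1 - F x1) / m * m * (1 - F x1).
    by rewrite divfK ?gt_eqF// divfK ?gt_eqF.
  apply: ler_pM => //.
  - by rewrite mulr_ge0 ?(ltW m0)// !divr_ge0// ltW.
  - exact: ltW.
  - apply: ler_pM => //; first by rewrite !divr_ge0// ltW.
    + exact: ltW.
    + by rewrite le_max lexx orbT.
  - by rewrite lerD2l lerN2 F_homo// ltW.
apply: (le_trans (ex _ xv)); rewrite lee_fin.
rewrite ler_pM2r// ler_pM2r//.
have l1 := ln1 _ xv.
case: ifP => [xl|_].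
  have l2 := ln1 _ xl.
  rewrite ler_pM2l// lef_pV2 ?posrE ?powR_gt0 ?(lt_le_trans ltr01)//.
  apply: ge0_ler_powR.
  - by rewrite addr_ge0// ltW.
  - by rewrite nnegrE (le_trans ler01).
  - by rewrite nnegrE (le_trans ler01).
  - by rewrite ler_ln ?posrE// (lt_le_trans _ xl)// (lt_le_trans (expR_gt0 1)).
rewrite le_max; apply/orP; left; rewrite ler_pdivrMr ?powR_gt0 ?(lt_le_trans ltr01)//.
rewrite ler_peMr ?(ltW c0)//.
apply: (@le_trans _ _ (1 `^ (1 + eps))); first by rewrite powR1.
apply: ge0_ler_powR; rewrite ?nnegrE//.
  by rewrite addr_ge0// ltW.
exact: le_trans ler01 l1.
Qed.

(** * Almost sure convergence *)

(** Taken in the extended reals, the limit of a nondecreasing sequence always exists; its finiteness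
    is a separate matter. *)
Definition final_sum (w : Omega) : \bar R := limn (fun i => (M (U i w))%:E).

Lemma final_sum_cvg w : (M (U i w))%:E @[i --> \oo] --> final_sum w.
Proof.
apply: ereal_nondecreasing_is_cvgn => i j ij.
by rewrite lee_fin selection_homo.
Qed.

Lemma measurable_M i : measurable_fun setT (fun w => M (U i w)).
Proof. by apply: measurableT_comp => //; exact: measurable_selection. Qed.

Lemma measurable_final_sum : measurable_fun setT final_sum.
Proof.
apply: (emeasurable_fun_cvg (fun i w => (M (U i w))%:E)).
  by move=> i; apply/measurable_EFinP; exact: measurable_M.
by move=> w _; exact: final_sum_cvg.
Qed.

(** [D] is bounded by [expR C], so E(M; X_0 >= m) is bounded uniformly in time; monotone convergence
    makes the limit integrable on that event, hence finite almost everywhere on it. *)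
Lemma ae_final_sum_lty_of_ge c eps m : 0 < c -> 0 < eps -> 0 < m ->
  (\forall x \near +oo, (f x < (c * x / ln x `^ (1 + eps))%:E)%E) ->
  {ae P, forall w, m <= X 0%N w -> (final_sum w < +oo)%E}.
Proof.
move=> c0 e0 m0 hf; have [delta [d0 [C hC] hd]] := drift_bound c0 e0 m0 hf.
pose D k := expR (\sum_(j < k) delta j * (beta / j.+1%:R)).
have D0 k : 0 < D k by exact: expR_gt0.
have DD k : D k * (1 + delta k * (beta / k.+1%:R)) <= D k.+1.
  rewrite /D big_ord_recr/= expRD; apply: ler_pM; rewrite ?expR_ge0 ?expR_ge1Dx//.
  by rewrite addr_ge0// mulr_ge0// divr_ge0// ltW.
have DC k : D k <= expR C by rewrite ler_expR.
have sup := weighted_supermartingale m0 D0 d0 DD hd.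
pose g i w : \bar R := (if m <= X 0%N w then M (U i w) else 0)%:E.
have g0 i w : (0 <= g i w)%E.
  by rewrite lee_fin; case: ifP => // _; exact: selection_ge0.
have mg i : measurable_fun setT (g i).
  apply/measurable_EFinP; apply: measurable_fun_ifT => //.
    exact: measurable_fun_ler.
  exact: measurable_M.
have nd w : {homo g ^~ w : i j / (i <= j)%N >-> (i <= j)%E}.
  by move=> i j ij; rewrite lee_fin; case: ifP => // _; exact: selection_homo.
have gC i : (\int[P]_w g i w <= (expR C)%:E * excess 0)%E.
  apply: (@le_trans _ _ ((expR C)%:E * \int[P]_w (weighted m D (U i w))%:E)%E).
    rewrite -ge0_integralZl_EFin ?expR_ge0//; last 2 first.
    - move=> w _; rewrite lee_fin /weighted; case: ifP => // _.
      by rewrite divr_ge0 ?selection_ge0// ltW.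
    - apply/measurable_EFinP.
      apply: (measurableT_comp (measurable_weighted m D)).
      exact: measurable_selection.
    apply: ge0_le_integral_nonmeasurable => w //.
    rewrite -EFinM lee_fin /weighted selection_first; case: ifP => _.
      rewrite mulrA ler_pdivlMr// mulrC ler_wpM2r ?selection_ge0//.
    by rewrite mulr0.
  apply: lee_wpmul2l; first by rewrite lee_fin expR_ge0.
  apply: (le_trans (sup i)).
  by rewrite /D big_ord0 expR0 invr1 mul1e.
have lim_lty : (\int[P]_w (limn (g ^~ w)) < +oo)%E.
  rewrite (monotone_convergence P measurableT mg)//.
  apply: (@le_lt_trans _ _ ((expR C)%:E * excess 0)%E).
    apply: lime_le; last exact: nearW.
    apply: ereal_nondecreasing_is_cvgn => i j ij.
    by apply: ge0_le_integral_nonmeasurable => w //; exact: nd.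
  by rewrite lte_mul_pinfty ?lee_fin ?expR_ge0// (excess0_lty hf).
have mlim : measurable_fun setT (fun w => limn (g ^~ w)).
  apply: (emeasurable_fun_cvg g) => // w _.
  by apply: ereal_nondecreasing_is_cvgn; exact: nd.
have lim0 w : (0 <= limn (g ^~ w))%E.
  by apply: lime_ge; [apply: ereal_nondecreasing_is_cvgn; exact: nd|exact: nearW].
have /integrable_ae : P.-integrable setT (fun w => limn (g ^~ w)).
  apply/integrableP; split => //.
  by under eq_integral do rewrite gee0_abs//.
move=> /(_ measurableT); apply: filterS => w /(_ Logic.I) + mX.
by have := lim0 w; rewrite /g mX => l0 fin; rewrite -ge0_fin_numE.
Qed.

Lemma ae_first_gt0 : distribution P (X 0%N) `<< lebesgue_measure ->
  {ae P, forall w, 0 < X 0%N w}.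
Proof.
move=> ac.
have m1 : measurable (X 0%N @^-1` [set 0]).
  by rewrite -[X in measurable X]setTI; exact: measurable_funP.
exists (X 0%N @^-1` [set 0]); split => //.
  apply: (ac [set 0]) => //.
  apply: negligible_null_set; exists [set 0]; split => //.
  exact: lebesgue_measure_set1.
move=> w /= /negP; rewrite -leNgt => Xle0.
by apply/eqP; rewrite eq_le Xle0 X_ge0.
Qed.

Lemma ae_final_sum_lty c eps : distribution P (X 0%N) `<< lebesgue_measure ->
  0 < c -> 0 < eps ->
  (\forall x \near +oo, (f x < (c * x / ln x `^ (1 + eps))%:E)%E) ->
  {ae P, forall w, (final_sum w < +oo)%E}.
Proof.
move=> ac c0 e0 hf.
have h : {ae P, forall w, forall n : nat, n.+1%:R^-1 <= X 0%N w -> (final_sum w < +oo)%E}.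
  by apply: ae_foralln => n; apply: ae_final_sum_lty_of_ge c0 e0 _ hf; rewrite invr_gt0.
have X0 := ae_first_gt0 ac.
apply: filterS2 h X0 => w h X0.
apply: (h (Num.bound (X 0%N w)^-1)); rewrite invf_ple ?posrE//.
by rewrite ltW// (lt_le_trans (archi_boundP _)) ?ler_nat// invr_ge0 ltW.
Qed.

Lemma scaled_avg_selection k w :
  (forall N n : nat, exists2 i, (n < i)%N & N%:R < X i w) ->
  scaled_avg (fun i => X i) beta k.+1 w =
  M (U (sel_time beta (X ^~ w) k) w) * (growth beta k / k.+1%:R `^ beta).
Proof. by move=> unb; rewrite /scaled_avg (scaled_avgE beta_ge1). Qed.

(** The limit is [rho] times the final normalized sum and dominates [rho] times the first
    observation, which gives positivity and, the law being unbounded, nondegeneracy. *)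
Lemma scaled_avg_cvg : distribution P (X 0%N) `<< lebesgue_measure ->
  (exists c eps : R, [/\ 0 < c, 0 < eps &
    \forall x \near +oo, (f x < (c * x / ln x `^ (1 + eps))%:E)%E]) ->
  exists Binf : {RV P >-> R},
    [/\ {ae P, forall w, scaled_avg (fun i => X i) beta k w @[k --> \oo] --> Binf w},
        {ae P, forall w, 0 < Binf w} &
        ~ exists c : R, {ae P, forall w, Binf w = c}].
Proof.
move=> ac [c [eps [c0 e0 hf]]].
have [rho rho0 hrho] := growth_ratio_cvg beta_gt1.
pose B w := rho * fine (final_sum w).
have mB : measurable_fun setT B.
  apply: measurable_funM => //; apply: measurableT_comp; first exact: fine_measurable.
  exact: measurable_final_sum.
pose Binf : {RV P >-> R} := HB.pack B (isMeasurableFun.Build _ _ _ _ _ mB).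
have fin := ae_final_sum_lty ac c0 e0 hf.
have cvM w : (final_sum w < +oo)%E -> M (U i w) @[i --> \oo] --> fine (final_sum w).
  move=> oo; have fs : final_sum w \is a fin_num.
    rewrite ge0_fin_numE//; apply: lime_ge.
      by apply/cvg_ex; exists (final_sum w); exact: final_sum_cvg.
    by apply: nearW => i; rewrite lee_fin selection_ge0.
  have h : (M (U i w))%:E @[i --> \oo] --> (fine (final_sum w))%:E.
    by rewrite fineK//; exact: final_sum_cvg.
  exact: (fine_cvg h).
have leM w i : (final_sum w < +oo)%E -> M (U i w) <= fine (final_sum w).
  move=> /cvM cv; rewrite -(cvg_lim _ cv)//.
  apply: nondecreasing_cvgn_le; first by move=> a b; exact: selection_homo.
  by apply/cvg_ex; exists (fine (final_sum w)).
have B_ge : {ae P, forall w, rho * X 0%N w <= Binf w}.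
  apply: filterS fin => w oo; rewrite /Binf/= /B ler_pM2l//.
  exact: le_trans (selection_ge_first 0 w) (leM _ _ oo).
exists Binf; split.
- apply: filterS2 fin ae_unbounded => w oo unb.
  rewrite -cvg_shiftS /=.
  rewrite (_ : (fun k => scaled_avg _ _ _ _) = (fun k =>
    M (U (sel_time beta (X ^~ w) k) w) * (growth beta k / k.+1%:R `^ beta))); last first.
    by apply/funext => k; rewrite scaled_avg_selection.
  rewrite /B mulrC; apply: cvgM => //.
  (* The selection of index k occurs at time k or later, so [M] there lies between its value at time
     k and its limit. *)
  apply: (squeeze_cvgr _ (cvM w oo) (cvg_cst (fine (final_sum w)))).
  apply: nearW => k; rewrite leM// andbT; apply: selection_homo.
  exact: leq_sel_time.
- apply: filterS2 B_ge (ae_first_gt0 ac) => w h X0.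
  by rewrite (lt_le_trans _ h)// mulr_gt0.
- move=> [b hb].
  (* A constant limit [b] would bound the first observation by [b / rho] almost surely. *)
  have : {ae P, forall w, X 0%N w <= b / rho}.
    apply: filterS2 B_ge hb => w + <-.
    by rewrite ler_pdivlMr// mulrC.
  move=> [N [mN N0 sub]].
  have : (P (X 0%N @^-1` `](b / rho)%R, +oo[%classic) <= P N)%E.
    apply: le_measure; rewrite ?inE//.
      by rewrite -[X in measurable X]setTI; exact: measurable_funP.
    move=> w /=; rewrite in_itv/= andbT => bX; apply: sub => /=.
    by apply/negP; rewrite -ltNge.
  rewrite N0 (_ : P _ = (1 - F (b / rho)%R)%:E); last exact: law_itvoy.
  by rewrite lee_fin leNgt F_lt1.
Qed.

(** * Consequences of bounded expectations *)

Lemma scaled_avg_ge0 k w : 0 <= scaled_avg (fun i => X i) beta k w.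
Proof.
rewrite /scaled_avg divr_ge0 ?powR_ge0// /sel_avg divr_ge0//.
by apply: sumr_ge0 => j _; exact: X_ge0.
Qed.

(** The selection of index k occurs at time k or later and [M] never decreases, so expectations at
    fixed times are controlled by those at selection times. *)
Lemma expectation_scaled_avg_ge k :
  ((growth beta k / k.+1%:R `^ beta)%:E * \int[P]_w (M (U k w))%:E <=
   'E_P[scaled_avg (fun i => X i) beta k.+1])%E.
Proof.
have [N [mN N0 sub]] := ae_unbounded.
set r := growth beta k / _.
have r0 : 0 <= r by rewrite divr_ge0 ?powR_ge0// ltW.
rewrite unlock -ge0_integralZl_EFin//; last 2 first.
- by move=> w _; rewrite lee_fin selection_ge0.
- by apply/measurable_EFinP; exact: measurable_M.
(* The null set is cut off on the measurable side; what remains is a pointwise comparison that asks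
   no measurability of [scaled_avg]. *)
pose h w := (r * M (U k w) * \1_(~` N) w)%:E.
have mh : measurable_fun setT h.
  apply/measurable_EFinP; apply: measurable_funM.
    by apply: measurable_funM => //; exact: measurable_M.
  by apply: measurable_indic; exact: measurableC.
have h0 w : (0 <= h w)%E.
  by rewrite lee_fin; do 2 apply: mulr_ge0 => //; exact: selection_ge0.
apply: (@le_trans _ _ (\int[P]_w h w)%E).
  apply: ae_ge0_le_integral => //.
  - by move=> w _; rewrite mule_ge0// lee_fin selection_ge0.
  - by apply: measurable_funeM; apply/measurable_EFinP; exact: measurable_M.
  exists N; split => // w /= /not_implyP[_].
  apply: contra_notP => nN.
  by rewrite /h indicE mem_set// mulr1.
apply: ge0_le_integral_nonmeasurable => // w.
rewrite /h indicE; have [Nw|Nw] := boolP (w \in ~` N); last first.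
  by rewrite mulr0 lee_fin scaled_avg_ge0.
have unb : forall N n : nat, exists2 i, (n < i)%N & N%:R < X i w.
  apply: contrapT => nw; move: Nw; rewrite inE => Nw; apply: Nw.
  exact: sub.
rewrite mulr1 lee_fin scaled_avg_selection// mulrC ler_wpM2r//.
by apply: selection_homo; exact: leq_sel_time.
Qed.

(** On the event that X_0 > 1 and the count has reached [n] by time [i], the left side of
    [drift_lower_bound] is at least the partial sum. As [i] grows, this event increases to X_0 > 1
    up to a null set. *)
Lemma drift_sum_le (C : R) (k0 : nat) (g : nat -> R) :
  (forall i, (k0 <= i)%N -> (\int[P]_w (M (U i w))%:E <= C%:E)%E) ->
  (forall k, 0 <= g k) ->
  (forall k v, min_threshold beta 1 k <= v ->
    ((g k * (1 - F v))%:E <= excess v)%E) ->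
  forall n, \sum_(k < n) g k / growth beta k.+1 <= C / (1 - F 1).
Proof.
move=> hC g0 hexc n.
pose G n := \sum_(k < n) g k / growth beta k.+1.
have gg0 k : 0 <= g k / growth beta k.+1 by rewrite divr_ge0// ltW.
have G0 m : 0 <= G m by apply: sumr_ge0.
have G_homo a b : (a <= b)%N -> G a <= G b.
  move=> /subnK <-; elim: (b - a)%N => // c IH.
  by rewrite (le_trans IH)// addSn /G big_ord_recr lerDl.
rewrite ler_pdivlMr// -/(G n).
have mU := measurable_selection.
pose E i := X 0%N @^-1` `]1, +oo[%classic `&` (fun w => (U i w).1.1) @^-1` [set j | (n <= j)%N].
have mE i : measurable (E i).
  apply: measurableI.
    by rewrite -[X in measurable X]setTI; exact: measurable_funP.
  rewrite -[X in measurable X]setTI.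
  by apply: (measurableT_comp (measurable_comp_count id) (mU i)).
have GE i : (k0 <= i)%N -> ((G n)%:E * P (E i) <= C%:E)%E.
  move=> k0i; apply: le_trans (hC i k0i).
  apply: le_trans (drift_lower_bound ltr01 g0 hexc i).
  rewrite -(setIT (E i)) -integral_indic// -ge0_integralZl_EFin//; last first.
    by apply/measurable_EFinP; exact: measurable_indic.
  apply: ge0_le_integral_nonmeasurable => w; rewrite -EFinM lee_fin.
    by rewrite mulr_ge0.
  rewrite indicE; have [|_] := boolP (w \in E i); last first.
    by rewrite mulr0; case: ifP => // _; exact: G0.
  rewrite inE /E /= in_itv/= andbT => -[X1 nU].
  by rewrite mulr1 (ltW X1); exact: G_homo.
have E_homo : nondecreasing_seq E.
  move=> i j ij; apply/subsetPset => w [X1 /= nU]; split => //=.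
  by apply: leq_trans nU _; exact: count_homo.
have mcup : measurable (\bigcup_i E i) by exact: bigcup_measurable.
have cvE := nondecreasing_cvg_mu mE mcup E_homo (mu := P).
have full : ((1 - F 1)%:E <= P (\bigcup_i E i))%E.
  rewrite (_ : (1 - F 1)%:E = P (X 0%N @^-1` `]1, +oo[%classic)); last first.
    by apply/esym; exact: law_itvoy.
  have [N [mN N0 sub]] := ae_unbounded.
  apply: (@le_trans _ _ (P (\bigcup_i E i `|` N))).
    apply: le_measure; rewrite ?inE.
    - by rewrite -[X in measurable X]setTI; exact: measurable_funP.
    - exact: measurableU.
    move=> w X1; have [Nw|Nw] := pselect (N w); [by right|left].
    have unb : forall N n : nat, exists2 i, (n < i)%N & N%:R < X i w.
      by apply: contrapT => nw; apply: Nw; exact: sub.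
    exists (sel_time beta (X ^~ w) n) => //; split => //=.
    exact: (count_sel_time unb).
  by rewrite measureU0.
rewrite -lee_fin EFinM.
apply: (@le_trans _ _ ((G n)%:E * P (\bigcup_i E i))%E).
  by apply: lee_wpmul2l; rewrite ?lee_fin.
have cvG : ((G n)%:E * P (E i))%E @[i --> \oo] --> ((G n)%:E * P (\bigcup_i E i))%E.
  by apply: cvgeZl.
rewrite -(cvg_lim _ cvG)//; apply: lime_le.
  by apply/cvg_ex; eexists; exact: cvG.
by exists k0.
Qed.

Lemma min_thresholdS k : min_threshold beta 1 k.+1 - min_threshold beta 1 k =
  min_threshold beta 1 k * ((beta - 1) / k.+2%:R).
Proof.
rewrite /min_threshold growthS !mulr1.
have : k.+2%:R = k.+1%:R + 1 :> R by rewrite natr1.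
have : (0 : R) < k.+1%:R by rewrite ltr0n.
move: (_.+2%:R) (_.+1%:R) (growth _ _) => p n g n0 ->; field.
by rewrite !gt_eqF// addr_gt0.
Qed.

(** By [min_thresholdS] the left side is (beta - 1) / ((k + 2) v_k) <= 1 / A_k, and two growth steps
    multiply A_k by at most (1 + beta)^2. *)
Lemma min_threshold_step_le k :
  (min_threshold beta 1 k.+1 - min_threshold beta 1 k) / min_threshold beta 1 k ^+ 2
    <= (1 + beta) ^+ 2 / growth beta k.+2.
Proof.
have lo0 : 0 < min_threshold beta 1 k.
  exact: lt_le_trans (self_le_min_threshold k ltr01).
rewrite min_thresholdS.
have -> : min_threshold beta 1 k * ((beta - 1) / k.+2%:R) / min_threshold beta 1 k ^+ 2
    = (beta - 1) / k.+2%:R / min_threshold beta 1 k.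
  move: (min_threshold _ _ _) lo0 (_.+2%:R^-1) => t t0 q; field.
  by rewrite gt_eqF.
rewrite !growthS /min_threshold mulr1 {lo0}.
have n1 : (1 : R) <= k.+1%:R by rewrite ler1n.
have n2 : k.+2%:R = k.+1%:R + 1 :> R by rewrite natr1.
have A0 := g_gt0 k.
rewrite n2; move: (k.+1%:R) n1 (growth _ _) A0 => n n1 A A0 {n2}.
have n0 : 0 < n by exact: lt_le_trans n1.
have le1 x : 1 <= x -> 1 + beta / x <= 1 + beta.
  move=> x1; rewrite lerD2l ler_pdivrMr ?(lt_le_trans ltr01)//.
  by rewrite ler_peMr// ltW.
have q1 x : 1 <= x -> 0 < 1 + beta / x.
  by move=> x1; rewrite addr_gt0// divr_gt0// (lt_le_trans ltr01).
have n11 : 1 <= n + 1 by rewrite lerDr ltW.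
apply: (@le_trans _ _ A^-1).
  have -> : (beta - 1) / (n + 1) / (beta / n * A) =
      A^-1 * ((beta - 1) / beta * (n / (n + 1))).
    by field; rewrite !gt_eqF// addr_gt0.
  rewrite ler_piMr ?invr_ge0 ?(ltW A0)//.
  rewrite mulr_ile1//.
  - by rewrite divr_ge0 ?(ltW beta_gt0)// subr_ge0.
  - by rewrite divr_ge0 ?(ltW n0)// addr_ge0// ltW.
  - by rewrite ler_pdivrMr// mul1r gerBl.
  - by rewrite ler_pdivrMr ?addr_gt0// mul1r lerDl.
rewrite ler_pdivlMr; last by rewrite !mulr_gt0 ?q1.
rewrite -!mulrA mulKf ?gt_eqF// expr2.
by apply: ler_pM; rewrite ?le1// ltW// q1.
Qed.

Lemma min_threshold_unbounded x : exists k, x < min_threshold beta 1 k.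
Proof.
have [a a0 ha] := min_threshold_ge beta_gt1 (@ltr01 R).
have b0 : 0 < beta - 1 by rewrite subr_gt0.
have [k0 hk] := powR_nat_unbounded ((x + 1) / a) b0.
exists k0; apply: lt_le_trans (ha k0).
rewrite (@lt_le_trans _ _ (x + 1)) ?ltrDl//.
by rewrite mulrC -ler_pdivrMr// hk.
Qed.

Lemma residual_integral_lty :
  {in `[0, +oo[ &, {homo f : x y / x <= y >-> (x <= y)%E}} \/
  {in `[0, +oo[ &, {homo f : x y / x <= y >-> (y <= x)%E}} ->
  (exists l : R, 'E_P[scaled_avg (fun i => X i) beta k]%E @[k --> \oo] --> l%:E) ->
  exists x0 : R, 0 < x0 /\
    (\int[lebesgue_measure]_(x in `[x0, +oo[) (f x * (x ^- 2)%:E) < +oo)%E.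
Proof.
move=> f_mono [l /fine_cvgP[Efin El]].
have [c c0 hc] := growth_ge beta_gt1.
have [N1 _ h1] := Efin.
have [N2 _ h2] : \forall k \near \oo,
    fine 'E_P[scaled_avg (fun i => X i) beta k]%E <= l + 1.
  by apply: (cvgr_le l) => //; rewrite ltrDl.
pose k0 := maxn N1 N2.
(* [growth_ge] turns the eventual bound [l + 1] on the expected scaled averages into a bound on the
   expected normalized sums. *)
have bound i : (k0 <= i)%N -> (\int[P]_w (M (U i w))%:E <= (c^-1 * (l + 1))%:E)%E.
  rewrite geq_max => /andP[i1 i2].
  rewrite EFinM lee_pdivlMl//.
  apply: (@le_trans _ _ 'E_P[scaled_avg (fun i => X i) beta i.+1]%E).
    apply: le_trans (expectation_scaled_avg_ge i).
    apply: lee_wpmul2r.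
      by apply: integral_ge0 => w _; rewrite lee_fin selection_ge0.
    by rewrite lee_fin ler_pdivlMr ?powR_gt0// hc.
  rewrite -(fineK (h1 i.+1 _)) ?lee_fin /=; last exact: leqW.
  by apply: (h2 i.+1) => /=; exact: leqW.
(* The first observation is at most [M], so its mean is finite, and then [f] is finite at
   nonnegative levels. *)
have e0 : (excess 0 < +oo)%E.
  apply: (@le_lt_trans _ _ (\int[P]_w (M (U k0 w))%:E)%E); last first.
    by rewrite (le_lt_trans (bound _ (leqnn _)))// ltry.
  rewrite excess0 unlock; apply: ge0_le_integral_nonmeasurable => w.
    by rewrite lee_fin.
  by rewrite lee_fin selection_ge_first.
have f_fin v : 0 <= v -> f v \is a fin_num.
  by move=> v0; exact: mean_residual_life_fin_num.
have f0 v : 0 <= fine (f v) by rewrite fine_ge0// mean_residual_life_ge0.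
have itvE v : 0 <= v -> v \in `[0, +oo[ by rewrite in_itv/= andbT.
have sqr_inv (a x : R) : 0 < a -> a <= x -> x ^- 2 <= a ^- 2.
  move=> a0 ax; rewrite lef_pV2 ?posrE ?exprn_gt0 ?(lt_le_trans a0 ax)//.
  by rewrite ler_pXn2r// nnegrE ltW// (lt_le_trans a0).
have f_ge0 (x : R) : (0 <= f x * (x ^- 2)%:E)%E.
  by rewrite mule_ge0 ?mean_residual_life_ge0// lee_fin invr_ge0 sqr_ge0.
case: f_mono => f_mono.
- pose lo := min_threshold beta 1.
  have lo1 k : 1 <= lo k by exact: self_le_min_threshold.
  have lo0 k : 0 < lo k by exact: lt_le_trans (lo1 k).
  have sumg := drift_sum_le bound (g := fun k => fine (f (lo k))) (fun k => f0 (lo k)).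
  exists (lo 0%N); split => //.
  set C1 := _ / _ in sumg.
  apply: (@le_lt_trans _ _ ((1 + beta) ^+ 2 * C1)%:E); last exact: ltry.
  (* On the step from v_k to v_(k + 1), [f] is at most its value at the right end and 1 / x^2 its
     value at the left end. *)
  apply: (@integral_le_steps _ lo (fun k => fine (f (lo k.+1)) / lo k ^+ 2)).
  + move=> k; rewrite -subr_ge0 min_thresholdS mulr_ge0// ?(ltW (lo0 _))//.
    by rewrite divr_ge0// subr_ge0.
  + exact: min_threshold_unbounded.
  + by move=> k; rewrite divr_ge0 ?sqr_ge0.
  + by [].
  + move=> k x lx xl; rewrite EFinM fineK ?f_fin ?(ltW (lo0 _))//.
    have x0 : 0 <= x by rewrite (le_trans _ lx)// ltW.
    apply: lee_pmul.
    * exact: mean_residual_life_ge0.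
    * by rewrite lee_fin invr_ge0 sqr_ge0.
    * by apply: f_mono => //; apply: itvE => //; exact: ltW.
    * by rewrite lee_fin; exact: sqr_inv.
  + move=> n.
    (* Because [f] is taken at right ends, step k is paid by term k + 1 of the drift sum, whence the
       range [n.+1]. *)
    apply: (@le_trans _ _ ((1 + beta) ^+ 2 *
        \sum_(k < n.+1) fine (f (lo k)) / growth beta k.+1)); last first.
      rewrite ler_wpM2l ?sqr_ge0//; apply: sumg => k v lv.
      rewrite excessE EFinM; apply: lee_wpmul2r; first by rewrite lee_fin ltW.
      rewrite fineK ?f_fin ?(ltW (lo0 _))//.
      by apply: f_mono => //; apply: itvE; rewrite ?(le_trans _ lv)// ltW.
    rewrite big_ord_recl mulrDr mulr_sumr -[leLHS]add0r; apply: lerD.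
      by rewrite mulr_ge0 ?sqr_ge0// divr_ge0// ltW.
    apply: ler_sum => k _.
    rewrite lift0 -mulrA [X in _ * X <= _]mulrC [leRHS]mulrCA ler_wpM2l//.
    exact: min_threshold_step_le.
(* A nonincreasing [f] is at most [f 0], and unit steps reduce the claim to the series of 1 /
   k^2. *)
- exists 1; split => //.
  pose C0 := fine (f 0).
  have C00 : 0 <= C0 by exact: f0.
  (* The local name [ln] denotes here the breakpoints k + 1, not the logarithm. *)
  pose ln (k : nat) : R := k.+1%:R.
  have ln0 k : 0 < ln k by rewrite ltr0n.
  pose u (k : nat) : R := C0 / ln k ^+ 2 * (ln k.+1 - ln k).
  have [C hC] : exists C, forall n, \sum_(k < n) u k <= C.
    (* For t >= 1, 1 / t^2 <= 2 (1 / t - 1 / (t + 1)). *)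
    apply: (@sum_le_of_telescope R u (fun k => 2 * C0 / ln k) 0).
      by move=> k; rewrite divr_ge0 ?(ltW (ln0 _))// mulr_ge0.
    move=> k _; rewrite /u.
    have -> : ln k.+1 = ln k + 1 by rewrite /ln natr1.
    have l1 : 1 <= ln k by rewrite ler1n.
    move: (ln k) (ln0 k) l1 => t t0 t1.
    have t10 : 0 < t + 1 by rewrite addr_gt0.
    have -> : C0 / t ^+ 2 * (t + 1 - t) = (t ^+ 2 * (t + 1))^-1 * (C0 * (t + 1)).
      by field; rewrite !gt_eqF.
    have -> : 2 * C0 / t - 2 * C0 / (t + 1) = (t ^+ 2 * (t + 1))^-1 * (C0 * (2 * t)).
      by field; rewrite !gt_eqF.
    apply: ler_wpM2l.
      by rewrite invr_ge0 mulr_ge0 ?sqr_ge0// ltW.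
    by apply: ler_wpM2l => //; rewrite mulr_natl mulr2n lerD2l.
  apply: (@le_lt_trans _ _ C%:E); last exact: ltry.
  apply: (@integral_le_steps _ ln (fun k => C0 / ln k ^+ 2)) => //.
  + by move=> k; rewrite ler_nat.
  + move=> x; exists (Num.bound `|x|); rewrite (le_lt_trans (ler_norm _))//.
    by rewrite (lt_trans (archi_boundP _))// ltr_nat.
  + by move=> k; rewrite divr_ge0 ?sqr_ge0.
  + move=> k x lx _; rewrite EFinM fineK ?f_fin//.
    have x0 : 0 <= x by rewrite (le_trans _ lx)// ltW.
    apply: lee_pmul.
    * exact: mean_residual_life_ge0.
    * by rewrite lee_fin invr_ge0 sqr_ge0.
    * by apply: f_mono => //; exact: itvE.
    * by rewrite lee_fin; exact: sqr_inv.
Qed.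

End iid.

Theorem theorem4p1 (R : realType) (d : measure_display)
    (Omega : measurableType d) (P : probability Omega R)
    (X : nat -> {RV P >-> R}) (F : R -> R) (beta : R)
    (X_ge0 : forall i w, 0 <= X i w)
    (X_indep : mutually_independent X)
    (X_cdf : forall i x, cdf (X i) x = (F x)%:E)
    (X_ac : distribution P (X 0%N) `<< lebesgue_measure)
    (F_lt1 : forall x, 0 < 1 - F x)
    (F_VM : von_mises F)
    (beta_gt1 : 1 < beta) :
  let B : nat -> Omega -> R := scaled_avg X beta in
  let f : R -> \bar R := mean_residual_life P (X 0%N) in
  ((exists c eps : R, [/\ 0 < c, 0 < eps &
      \forall x \near +oo, (f x < (c * x / ln x `^ (1 + eps))%:E)%E]) ->
   exists Binf : {RV P >-> R},
     [/\ {ae P, forall w, B k w @[k --> \oo] --> Binf w},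
         {ae P, forall w, 0 < Binf w} &
         ~ exists c : R, {ae P, forall w, Binf w = c}])
  /\
  ({ae P, forall w, cvg (B k w @[k --> \oo])} ->
   {in `[0, +oo[ &, {homo f : x y / x <= y >-> (x <= y)%E}} \/
   {in `[0, +oo[ &, {homo f : x y / x <= y >-> (y <= x)%E}} ->
   (exists l : R, 'E_P[B k]%E @[k --> \oo] --> l%:E) ->
   exists x0 : R, 0 < x0 /\
     (\int[lebesgue_measure]_(x in `[x0, +oo[) (f x * (x ^- 2)%:E) < +oo)%E).
Proof.
move=> B f; split.
  move=> hf.
  exact: (scaled_avg_cvg X_ge0 X_indep X_cdf F_lt1 beta_gt1 X_ac hf).
move=> _ f_mono hB.
exact: (residual_integral_lty X_ge0 X_indep X_cdf F_lt1 beta_gt1 f_mono hB).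
Qed.
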